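(* Let $A=T(V)/(R)$ be an $N$-homogeneous algebra, and let $M$ and $P$ be $A$-bimodules. For any Koszul $p$-cochain $f$ with coefficients in $P$ and any Koszul $q$-chain $z$ with coefficients in $M$, one has $$b_K(f\underset{K}{\frown} z)=b_K(f)\underset{K}{\frown} z+(-1)^p f\underset{K}{\frown} b_K(z),$$ $$b_K(z\underset{K}{\frown} f)=b_K(z)\underset{K}{\frown} f+(-1)^q z\underset{K}{\frown} b_K(f).$$
   Context: $k$ is a field, $N\ge 2$ an integer, $V$ a $k$-vector space, $R\subseteq V^{\otimes N}$ a subspace, and $A=T(V)/(R)$, graded by weight ($V$ in weight 1). $\otimes$ means $\otimes_k$; $A$-bimodules are left modules over $A^e=A\otimes A^{op}$. For $p\ge 0$, $W_p=\bigcap_{i+N+j=p}V^{\otimes i}\otimes R\otimes V^{\otimes j}\subseteq V^{\otimes p}$ (so $W_p=V^{\otimes p}$ for $p<N$, $W_N=R$). Define $\nu(2p')=Np'$ and $\nu(2p'+1)=Np'+1$. An arbitrary element of $W_p$ is written as a product $x_1\ldots x_p$ with $x_i\in V$ (a linear combination of such tensors is understood); when $q+r+s=p$, viewing it in $V^{\otimes q}\otimes W_r\otimes V^{\otimes s}$, the factor $x_{q+1}\ldots x_{q+r}$ is thought of as an element of $W_r$. All formulas are extended linearly. Koszul $p$-cochains with coefficients in a bimodule $M$ are the elements of $Hom(W_{\nu(p)},M)$, with differential: if $p=2p'$, $$b_K(f)(x_1\ldots x_{Np'+1})=f(x_1\ldots x_{Np'})x_{Np'+1}-x_1f(x_2\ldots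 x_{Np'+1});$$ if $p=2p'+1$, $$b_K(f)(x_1\ldots x_{Np'+N})=\sum_{0\le i\le N-1}x_1\ldots x_i f(x_{i+1}\ldots x_{i+Np'+1})x_{i+Np'+2}\ldots x_{Np'+N}.$$ Koszul $q$-chains with coefficients in $M$ are the elements of $M\otimes W_{\nu(q)}$; the differential of $z=m\otimes x_1\ldots x_{\nu(q)}$ is $$b_K(z)=mx_1\otimes x_2\ldots x_{Nq'+1}-x_{Nq'+1}m\otimes x_1\ldots x_{Nq'}\quad (q=2q'+1),$$ $$b_K(z)=\sum_{0\le i\le N-1}x_{i+Nq'-N+2}\ldots x_{Nq'}\,m\,x_1\ldots x_i\otimes x_{i+1}\ldots x_{i+Nq'-N+1}\quad (q=2q'>0),$$ and $b_K=0$ on 0-chains. Koszul cap products: for $f:W_{\nu(p)}\to P$ and $z=m\otimes x_1\ldots x_{\nu(q)}\in M\otimes W_{\nu(q)}$, $f\underset{K}{\frown} z$ and $z\underset{K}{\frown} f$ are $(q-p)$-chains with coefficients in $P\otimes_A M$ and $M\otimes_A P$ respectively, zero if $q<p$, and otherwise defined as follows. If $p$ and $q-p$ are not both odd (so $\nu(q-p)=\nu(q)-\nu(p)$), $$f\underset{K}{\frown} z=(f(x_{\nu(q-p)+1}\ldots x_{\nu(q)})\otimes_A m)\otimes x_1\ldots x_{\nu(q-p)},$$ $$z\underset{K}{\frown} f=(-1)^{pq}(m\otimes_A f(x_1\ldots x_{\nu(p)}))\otimes x_{\nu(p)+1}\ldots x_{\nu(q)}.$$ If $p=2p'+1$ and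 $q=2q'$ (sums over integers $i,j\ge0$), $$f\underset{K}{\frown} z=-\sum_{0\le i+j\le N-2}(x_{Nq'-Np'-N+i+2}\ldots x_{Nq'-Np'-j-1}f(x_{Nq'-Np'-j}\ldots x_{Nq'-j})\otimes_A x_{Nq'-j+1}\ldots x_{Nq'}\,m\,x_1\ldots x_i)\otimes x_{i+1}\ldots x_{i+Nq'-Np'-N+1},$$ $$z\underset{K}{\frown} f=\sum_{0\le i+j\le N-2}(x_{Nq'-j+1}\ldots x_{Nq'}\,m\,x_1\ldots x_i\otimes_A f(x_{i+1}\ldots x_{Np'+i+1})x_{Np'+i+2}\ldots x_{Np'+N-j-1})\otimes x_{Np'+N-j}\ldots x_{Nq'-j}.$$ *)

(* Defs.v *)
From HB Require Import structures.
From mathcomp Require Import all_boot all_algebra.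
From mathcomp Require Import boolp classical_sets.
From mathcomp Require Import finmap monalg zify.

Set Implicit Arguments.
Unset Strict Implicit.
Unset Printing Implicit Defensive.

Import GRing.Theory.
Local Open Scope ring_scope.
Local Open Scope quotient_scope.

Section LinearSpan.
Variables (k : fieldType) (E : lmodType k) (B : E -> Prop).

Definition lspan : {pred E} := fun x =>
  `[< exists s : seq (k * E), (forall ce, ce \in s -> B ce.2) /\
        x = \sum_(ce <- s) ce.1 *: ce.2 >].

Lemma lspan_closed : submod_closed lspan.
Proof.
split=> [|c x y /asboolP[s [sB ->]] /asboolP[t [tB ->]]].
  by apply/asboolP; exists [::]; rewrite big_nil.
apply/asboolP; exists ([seq (c * ce.1, ce.2) | ce <- s] ++ t); split=> [ce|].
  by rewrite mem_cat => /orP[/mapP[a /sB Ba ->]|/tB].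
rewrite big_cat big_map /= scaler_sumr; congr (_ + _).
by apply: eq_bigr => ce _; rewrite scalerA.
Qed.

HB.instance Definition _ := GRing.isSubmodClosed.Build k E lspan lspan_closed.

Lemma mem_lspan x : B x -> x \in lspan.
Proof.
move=> Bx; apply/asboolP; exists [:: (1, x)]; rewrite big_seq1 scale1r.
by split=> // ce; rewrite inE => /eqP ->.
Qed.

Lemma lspan_ind (P : E -> Prop) : P 0 ->
  (forall c x y, B x -> P y -> P (c *: x + y)) -> forall x, x \in lspan -> P x.
Proof.
move=> P0 PD x /asboolP[s [sB ->]]; elim: s sB => [|ce s IH] sB.
  by rewrite big_nil.
rewrite big_cons; apply: PD; first by apply: sB; rewrite mem_head.
by apply: IH => a sa; apply: sB; rewrite inE sa orbT.
Qed.

Lemma lspan_ker (F : lmodType k) (g : E -> F) : linear g ->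
  (forall x, B x -> g x = 0) -> forall x, x \in lspan -> g x = 0.
Proof.
move=> gl gB; apply: lspan_ind => [|c x y Bx gy].
  by have := gl (-1) 0 0; rewrite scaler0 addr0 scaleN1r addNr.
by rewrite gl gy gB // scaler0 addr0.
Qed.

End LinearSpan.

(* The operations of quotients are locked, as unification would otherwise
   unfold them down to the free algebra. *)
Fact quo_key : unit. Proof. exact: tt. Qed.

Section QuotientModule.
Variables (k : fieldType) (E : lmodType k) (S : submodClosed E).

Definition quo_rel (x y : E) := x - y \in S.

Lemma submodB x y : x \in S -> y \in S -> x - y \in S.
Proof. by move=> xS yS; rewrite -scaleN1r rpredD ?rpredZ. Qed.

Lemma quo_relP : equiv_class_of quo_rel.
Proof.
split=> [x|x y|y x z]; rewrite /quo_rel; first by rewrite subrr rpred0.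
  by apply/idP/idP => /(rpredZ (-1)); rewrite scaleN1r opprB.
move=> xy yz; have := rpredD xy yz.
by rewrite addrA subrK.
Qed.

Canonical quo_equiv := EquivRelPack quo_relP.
Definition quo : Type := {eq_quot quo_rel}.
HB.instance Definition _ := Choice.on quo.

Definition quo_pi : E -> quo :=
  locked_with quo_key (fun x => \pi_({eq_quot quo_rel}) x).
Definition quo_repr : quo -> E :=
  locked_with quo_key (fun a => repr (a : {eq_quot quo_rel})).

Lemma quo_reprK a : quo_pi (quo_repr a) = a.
Proof. by rewrite /quo_pi /quo_repr !locked_withE; exact: reprK. Qed.

Lemma quo_piP x y : quo_pi x = quo_pi y <-> x - y \in S.
Proof.
by rewrite /quo_pi locked_withE; split=> [/eqmodP //|xy]; apply/eqmodP.
Qed.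

Lemma quo_repr_pi x : quo_repr (quo_pi x) - x \in S.
Proof. by apply/quo_piP; rewrite quo_reprK. Qed.

Definition quo_add :=
  locked_with quo_key (fun a b => quo_pi (quo_repr a + quo_repr b)).
Definition quo_opp := locked_with quo_key (fun a => quo_pi (- quo_repr a)).
Definition quo_scale :=
  locked_with quo_key (fun (c : k) a => quo_pi (c *: quo_repr a)).

Lemma quo_addE x y : quo_add (quo_pi x) (quo_pi y) = quo_pi (x + y).
Proof.
by rewrite /quo_add locked_withE; apply/quo_piP; rewrite opprD addrACA; apply: rpredD; apply: quo_repr_pi. Qed.

Lemma quo_oppE x : quo_opp (quo_pi x) = quo_pi (- x).
Proof.
by have := rpredZ (-1) (quo_repr_pi x); rewrite scaleN1r opprB => h;
  rewrite /quo_opp locked_withE; apply/quo_piP; rewrite opprK addrC.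
Qed.

Lemma quo_scaleE c x : quo_scale c (quo_pi x) = quo_pi (c *: x).
Proof.
by rewrite /quo_scale locked_withE; apply/quo_piP; rewrite -scalerBr; apply: rpredZ; exact: quo_repr_pi. Qed.

Lemma quo_ind (P : quo -> Prop) : (forall x, P (quo_pi x)) -> forall a, P a.
Proof. by move=> Px a; rewrite -(quo_reprK a). Qed.

Lemma quo_addA : associative quo_add.
Proof.
by elim/quo_ind=> x; elim/quo_ind=> y; elim/quo_ind=> z; rewrite !quo_addE addrA.
Qed.
Lemma quo_addC : commutative quo_add.
Proof. by elim/quo_ind=> x; elim/quo_ind=> y; rewrite !quo_addE addrC. Qed.
Lemma quo_add0 : left_id (quo_pi 0) quo_add.
Proof. by elim/quo_ind=> x; rewrite quo_addE add0r. Qed.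
Lemma quo_addN : left_inverse (quo_pi 0) quo_opp quo_add.
Proof. by elim/quo_ind=> x; rewrite quo_oppE quo_addE addNr. Qed.

HB.instance Definition _ :=
  GRing.isZmodule.Build quo quo_addA quo_addC quo_add0 quo_addN.

Lemma quo_scaleA c d a : quo_scale c (quo_scale d a) = quo_scale (c * d) a.
Proof. by elim/quo_ind: a => x; rewrite !quo_scaleE scalerA. Qed.
Lemma quo_scale1 : left_id 1 quo_scale.
Proof. by elim/quo_ind=> x; rewrite quo_scaleE scale1r. Qed.
Lemma quo_scaleDr : right_distributive quo_scale +%R.
Proof.
move=> c; elim/quo_ind=> x; elim/quo_ind=> y.
by rewrite [quo_pi x + _]quo_addE !quo_scaleE scalerDr [RHS]quo_addE.
Qed.
Lemma quo_scaleDl a : {morph quo_scale^~ a : c d / c + d}.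
Proof.
move=> c d; elim/quo_ind: a => x.
by rewrite !quo_scaleE scalerDl [RHS]quo_addE.
Qed.

HB.instance Definition _ := GRing.Zmodule_isLmodule.Build k quo
  quo_scaleA quo_scale1 quo_scaleDr quo_scaleDl.

Lemma quo_pi_linear : linear quo_pi.
Proof.
by move=> c x y; rewrite [_ *: quo_pi x]quo_scaleE [RHS]quo_addE.
Qed.

HB.instance Definition _ := GRing.isLinear.Build k E quo *:%R quo_pi quo_pi_linear.

Lemma quo_pi_eq0 x : x \in S -> quo_pi x = 0.
Proof. by move=> xS; apply/quo_piP; rewrite subr0. Qed.

Section Lift.
Variables (F : lmodType k) (g : E -> F).
Hypotheses (g_lin : linear g) (gS : forall x, x \in S -> g x = 0).

Lemma quo_liftE x : g (quo_repr (quo_pi x)) = g x.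
Proof.
have := gS (quo_repr_pi x); rewrite addrC -scaleN1r g_lin scaleN1r.
by move/eqP; rewrite addrC subr_eq0 => /eqP.
Qed.

Lemma quo_lift_linear : linear (g \o quo_repr).
Proof.
move=> c; elim/quo_ind=> x; elim/quo_ind=> y.
by rewrite /= -linearP !quo_liftE g_lin.
Qed.
End Lift.

End QuotientModule.

Section FreeModule.
Variables (k : fieldType) (K : choiceType) (F : lmodType k).

Definition free_ext (g : K -> F) (x : {malg k[K]}) : F :=
  \sum_(s <- msupp x) x@_s *: g s.

Lemma free_extw g (d : {fset K}) x : (msupp x `<=` d)%fset ->
  free_ext g x = \sum_(s <- d) x@_s *: g s.
Proof.
move=> le; rewrite /free_ext (big_fset_incl _ le) // => s _ /mcoeff_outdom ->.
by rewrite scale0r.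
Qed.

Lemma free_ext_linear g : linear (free_ext g).
Proof.
move=> c x y; pose d := (msupp x `|` msupp y `|` msupp (c *: x + y))%fset.
rewrite !(free_extw g (d := d)).
- rewrite scaler_sumr -big_split; apply: eq_bigr => s _ /=.
  by rewrite mcoeffD mcoeffZ scalerDl scalerA.
- by apply/fsubsetP => s; rewrite !inE => ->; rewrite orbT.
- by apply/fsubsetP => s; rewrite !inE => ->.
- by apply/fsubsetP => s; rewrite !inE => ->; rewrite orbT.
Qed.

HB.instance Definition _ g :=
  GRing.isLinear.Build k {malg k[K]} F *:%R (free_ext g) (free_ext_linear g).

Lemma free_extU g s : free_ext g << s >> = g s.
Proof.
by rewrite (free_extw g (msuppU_le)) big_seq_fset1 mcoeffUU scale1r.
Qed.

Lemma free_ind (P : {malg k[K]} -> Prop) : P 0 ->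
  (forall c s x, P x -> P (c *: << s >> + x)) -> forall x, P x.
Proof.
move=> P0 PD x; rewrite (monalgE x); elim/big_rec: _ => // s y _ Py.
suff -> : << x@_s *g s >> = x@_s *: << s >> :> {malg k[K]} by apply: PD.
by apply/malgP => t; rewrite mcoeffZ !mcoeffU mulr_natr.
Qed.

End FreeModule.

Definition bilin (k : fieldType) (U V W : lmodType k) (phi : U -> V -> W) :=
  (forall v, linear (phi^~ v)) /\ (forall u, linear (phi u)).

Section TensorProduct.
Variables (k : fieldType) (U V : lmodType k).

(* $U \otimes_k V$ is the free module on the pairs modulo bilinearity. *)
Inductive tens_rel : {malg k[(U * V)%type]} -> Prop :=
| TensRelL c u u' v :
    tens_rel (<< (c *: u + u', v) >> - (c *: << (u, v) >> + << (u', v) >>))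
| TensRelR c u v v' :
    tens_rel (<< (u, c *: v + v') >> - (c *: << (u, v) >> + << (u, v') >>)).

Definition tens : Type := quo (lspan tens_rel).
HB.instance Definition _ := GRing.Lmodule.on tens.

Definition tpure (u : U) (v : V) : tens := quo_pi (lspan tens_rel) << (u, v) >>.

Lemma tpure_bilin : bilin tpure.
Proof.
split=> [v c u u'|u c v v']; apply/eqP; rewrite /tpure -subr_eq0 -linearP -linearB.
  by apply/eqP/quo_pi_eq0/mem_lspan/TensRelL.
by apply/eqP/quo_pi_eq0/mem_lspan/TensRelR.
Qed.

(* The linear map $u \otimes v \mapsto \phi(u, v)$ when [phi] is bilinear, see
   [tlift_linear] and [tlift_pure]. *)
Definition tlift (F : lmodType k) (phi : U -> V -> F) (z : tens) : F :=
  free_ext (fun uv => phi uv.1 uv.2) (quo_repr z).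

Section Lift.
Variables (F : lmodType k) (phi : U -> V -> F).
Hypothesis phiP : bilin phi.

Lemma tlift_ker x :
  x \in lspan tens_rel -> free_ext (fun uv => phi uv.1 uv.2) x = 0.
Proof.
apply: lspan_ker; first exact: linearP.
case: phiP => pl pr _ [c u u' v|c u v v']; rewrite linearB linearP /= !free_extU /=.
  by rewrite pl subrr.
by rewrite pr subrr.
Qed.

Lemma tlift_linear : linear (tlift phi).
Proof. by apply: quo_lift_linear; [exact: linearP | exact: tlift_ker]. Qed.

Lemma tlift_pure u v : tlift phi (tpure u v) = phi u v.
Proof.
by rewrite /tlift quo_liftE ?free_extU //; [exact: linearP | exact: tlift_ker].
Qed.
End Lift.

Lemma tens_ind (P : tens -> Prop) : P 0 ->
  (forall u v z, P z -> P (tpure u v + z)) -> forall z, P z.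
Proof.
move=> P0 PD; elim/quo_ind; elim/free_ind => [|c [u v] x IH].
  by rewrite linear0.
rewrite linearP /= -/(tpure u v).
have -> : c *: tpure u v = tpure (c *: u) v.
  have := tpure_bilin.1 v c u 0; rewrite addr0 => ->.
  by have := tpure_bilin.1 v (-1) 0 0; rewrite scaler0 addr0 scaleN1r addNr => ->; rewrite addr0.
exact: PD.
Qed.

End TensorProduct.

(* Two-sided; properness is required because MathComp algebras are nontrivial. *)
Record proper_ideal (k : fieldType) (E : algType k) := ProperIdeal {
  ideal_space :> submodClosed E;
  ideal_mul : forall a x b, x \in ideal_space -> a * x * b \in ideal_space;
  ideal_proper : 1 \notin ideal_space }.

Section QuotientAlgebra.
Variables (k : fieldType) (E : algType k) (I : proper_ideal E).

Definition quoalg : Type := quo I.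
HB.instance Definition _ := GRing.Lmodule.on quoalg.

Definition quoalg_pi : E -> quoalg := quo_pi I.
Definition quoalg_mul : quoalg -> quoalg -> quoalg :=
  locked_with quo_key (fun a b => quo_pi I (quo_repr a * quo_repr b)).

Lemma quoalg_mulE x y : quoalg_mul (quoalg_pi x) (quoalg_pi y) = quoalg_pi (x * y).
Proof.
rewrite /quoalg_mul locked_withE; apply/quo_piP; set x' := quo_repr _; set y' := quo_repr _.
have -> : x' * y' - x * y = 1 * (x' - x) * y' + x * (y' - y) * 1.
  by rewrite mul1r mulr1 mulrBl mulrBr addrA subrK.
by apply: rpredD; apply: ideal_mul; apply: quo_repr_pi.
Qed.

Lemma quoalg_mulA : associative quoalg_mul.
Proof.
elim/quo_ind=> x; elim/quo_ind=> y; elim/quo_ind=> z.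
by rewrite -!/(quoalg_pi _) !quoalg_mulE mulrA.
Qed.
Lemma quoalg_mul1 : left_id (quoalg_pi 1) quoalg_mul.
Proof. by elim/quo_ind=> x; rewrite -!/(quoalg_pi _) quoalg_mulE mul1r. Qed.
Lemma quoalg_mulr1 : right_id (quoalg_pi 1) quoalg_mul.
Proof. by elim/quo_ind=> x; rewrite -!/(quoalg_pi _) quoalg_mulE mulr1. Qed.
Lemma quoalg_addE x y : quoalg_pi x + quoalg_pi y = quoalg_pi (x + y).
Proof. exact: quo_addE. Qed.
Lemma quoalg_scaleE c x : c *: quoalg_pi x = quoalg_pi (c *: x).
Proof. exact: quo_scaleE. Qed.
Lemma quoalg_mulDl : left_distributive quoalg_mul +%R.
Proof.
elim/quo_ind=> x; elim/quo_ind=> y; elim/quo_ind=> z.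
by rewrite -!/(quoalg_pi _) !(quoalg_addE, quoalg_mulE) mulrDl.
Qed.
Lemma quoalg_mulDr : right_distributive quoalg_mul +%R.
Proof.
elim/quo_ind=> x; elim/quo_ind=> y; elim/quo_ind=> z.
by rewrite -!/(quoalg_pi _) !(quoalg_addE, quoalg_mulE) mulrDr.
Qed.
Lemma quoalg_1neq0 : quoalg_pi 1 != 0.
Proof.
apply: contra (ideal_proper I) => /eqP/quo_piP.
by rewrite subr0.
Qed.

HB.instance Definition _ := GRing.Zmodule_isNzRing.Build quoalg
  quoalg_mulA quoalg_mul1 quoalg_mulr1 quoalg_mulDl quoalg_mulDr quoalg_1neq0.

Lemma quoalg_scaleAl c (a b : quoalg) : c *: (a * b) = c *: a * b.
Proof.
elim/quo_ind: a => x; elim/quo_ind: b => y; rewrite -!/(quoalg_pi _).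
by rewrite [quoalg_pi x * _]quoalg_mulE !quoalg_scaleE scalerAl [RHS]quoalg_mulE.
Qed.
Lemma quoalg_scaleAr c (a b : quoalg) : c *: (a * b) = a * (c *: b).
Proof.
elim/quo_ind: a => x; elim/quo_ind: b => y; rewrite -!/(quoalg_pi _).
by rewrite [quoalg_pi x * _]quoalg_mulE !quoalg_scaleE scalerAr [RHS]quoalg_mulE.
Qed.

HB.instance Definition _ := GRing.Lmodule_isLalgebra.Build k quoalg quoalg_scaleAl.
HB.instance Definition _ := GRing.Lalgebra_isAlgebra.Build k quoalg quoalg_scaleAr.

HB.instance Definition _ :=
  GRing.isLinear.Build k E quoalg *:%R quoalg_pi (quo_pi_linear I).

Lemma quoalg_pi_monoid : monoid_morphism quoalg_pi.
Proof. by split=> // x y; rewrite [RHS]quoalg_mulE. Qed.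

HB.instance Definition _ :=
  GRing.isMonoidMorphism.Build E quoalg quoalg_pi quoalg_pi_monoid.

Lemma quoalg_ind (P : quoalg -> Prop) : (forall x, P (quoalg_pi x)) -> forall a, P a.
Proof. exact: quo_ind. Qed.

End QuotientAlgebra.

Section IdealSpan.
Variables (k : fieldType) (E : algType k) (B : E -> Prop).

Definition sandwich (x : E) := exists a y b, B y /\ x = a * y * b.
Definition ideal_span : {pred E} := lspan sandwich.
HB.instance Definition _ := GRing.SubmodClosed.on ideal_span.

Lemma mem_ideal_span x : B x -> x \in ideal_span.
Proof. by move=> Bx; apply: mem_lspan; exists 1, x, 1; rewrite mul1r mulr1. Qed.

Lemma ideal_span_mul a x b : x \in ideal_span -> a * x * b \in ideal_span.
Proof.
elim/lspan_ind => [|c y z [a' [y' [b' [By ->]]]] IH].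
  by rewrite mulr0 mul0r rpred0.
rewrite mulrDr mulrDl -scalerAr -scalerAl; apply: rpredD => //; apply: rpredZ.
by apply: mem_lspan; exists (a * a'), y', (b' * b); rewrite !mulrA.
Qed.

End IdealSpan.

Section SandwichKernel.
Variables (k : fieldType) (E : algType k) (F : lmodType k) (h : {linear E -> F}).

Lemma linear_sandwich (I : Type) (u : I -> E) y :
  (forall P : E -> Prop, P 0 ->
    (forall c i x, P x -> P (c *: u i + x)) -> forall x, P x) ->
  (forall i j, h (u i * y * u j) = 0) -> forall a b, h (a * y * b) = 0.
Proof.
move=> u_ind huyu a b.
have huy i c : h (u i * y * c) = 0.
  elim/u_ind: c => [|d j c IH]; first by rewrite mulr0 linear0.
  by rewrite mulrDr -scalerAr linearP IH huyu scaler0 addr0.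
elim/u_ind: a => [|c i a IH]; first by rewrite !mul0r linear0.
by rewrite !mulrDl -!scalerAl linearP IH huy scaler0 addr0.
Qed.

Lemma linear_sandwichD a b c x y z : h (a * (x - (c *: y + z)) * b) =
  h (a * x * b) - (c *: h (a * y * b) + h (a * z * b)).
Proof.
by rewrite mulrBr mulrBl mulrDr mulrDl -scalerAr -scalerAl linearB linearP.
Qed.

End SandwichKernel.

Section FreeAlgebra.
Variables (k : fieldType) (V : lmodType k).

Lemma malg_scaleAr (K : monomType) c (x y : {malg k[K]}) :
  c *: (x * y) = x * (c *: y).
Proof.
suff cC (z : {malg k[K]}) : c%:MP * z = z * c%:MP.
  by rewrite -[c *: y]mul_malgC mulrA -cC -mulrA mul_malgC.
rewrite [LHS]fgmulUg [RHS]fgmulgU; apply: eq_bigr => m _.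
by rewrite mul1m mulm1 mulrC.
Qed.

Definition freealg : Type := {malg k[{fmonom V}]}.
HB.instance Definition _ := GRing.Lalgebra.on freealg.
HB.instance Definition _ :=
  GRing.Lalgebra_isAlgebra.Build k freealg (@malg_scaleAr _).

Definition fword : seq V -> freealg := locked_with quo_key (fun s => << FMonom s >>).

Lemma fwordM s t : fword (s ++ t) = fword s * fword t.
Proof.
rewrite /fword locked_withE [RHS]fgmulUU mulr1.
by congr << _ >>; apply/val_inj; rewrite /= fmM.
Qed.

Lemma fword1 : fword [::] = 1.
Proof.
by rewrite /fword locked_withE; congr << _ >>; apply/val_inj; rewrite /= fm1.
Qed.

Lemma freealg_ind (P : freealg -> Prop) : P 0 ->
  (forall c s x, P x -> P (c *: fword s + x)) -> forall x, P x.
Proof.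
rewrite /fword locked_withE => P0 PD x.
by apply: (free_ind P0) => c [s] y /PD; apply.
Qed.

Definition fword_ext (F : lmodType k) (g : seq V -> F) : freealg -> F :=
  locked_with quo_key (free_ext (fun s : {fmonom V} => g s)).

Lemma fword_ext_linear (F : lmodType k) (g : seq V -> F) : linear (fword_ext g).
Proof. by rewrite /fword_ext locked_withE; exact: free_ext_linear. Qed.

Lemma fword_extE (F : lmodType k) (g : seq V -> F) s : fword_ext g (fword s) = g s.
Proof. by rewrite /fword_ext /fword !locked_withE; exact: free_extU. Qed.

End FreeAlgebra.
HB.instance Definition _ (k : fieldType) (V F : lmodType k) (g : seq V -> F) :=
  GRing.isLinear.Build k (freealg V) F *:%R (fword_ext g) (fword_ext_linear g).



Definition multilinear (k : fieldType) (V F : lmodType k) (n : nat) (g : seq V -> F) :=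
  forall s t c v w, (size s + size t).+1 = n ->
    g (s ++ (c *: v + w) :: t) = c *: g (s ++ v :: t) + g (s ++ w :: t).

Section SandwichWord.
Variables (k : fieldType) (V F : lmodType k) (n : nat) (g : seq V -> F).
Variables (E : algType k) (u : seq V -> E) (h : {linear E -> F}).
Hypothesis uM : forall s t, u (s ++ t) = u s * u t.
Hypothesis hu : forall s, h (u s) = if size s == n then g s else 0.

Lemma linear_sandwich_word s t c v w : multilinear n g ->
  h (u s * (u [:: c *: v + w] - (c *: u [:: v] + u [:: w])) * u t) = 0.
Proof.
move=> g_mult; rewrite linear_sandwichD -!uM !hu -!catA !size_cat /= !addnS.
case: eqP => [/g_mult -> |_]; first by rewrite subrr.
by rewrite scaler0 addr0 subrr.
Qed.

End SandwichWord.

(* $T(V)$ is the free algebra on the elements of [V] modulo the linearity of the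
   inclusion of [V]. *)
Section TensorAlgebra.
Variables (k : fieldType) (V : lmodType k).

Inductive tensalg_rel : freealg V -> Prop :=
| TensalgRel c v w : tensalg_rel
    (fword [:: c *: v + w] - (c *: fword [:: v] + fword [:: w])).

Section Evaluation.
Variables (F : lmodType k) (n : nat) (g : seq V -> F).

Definition weight_ext : seq V -> F :=
  fun s => if size s == n then g s else 0.

Hypothesis g_mult : multilinear n g.

Lemma weight_ext_ker x :
  x \in ideal_span tensalg_rel -> fword_ext weight_ext x = 0.
Proof.
apply: lspan_ker => [|_ [a [_ [b [[c v w] ->]]]]]; first exact: linearP.
apply: (linear_sandwich (u := @fword k V)) => [P P0 PD|s t].
  exact: freealg_ind.
apply: (@linear_sandwich_word k V F n g) => //; first exact: fwordM.
exact: fword_extE.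
Qed.
End Evaluation.

Lemma tensalg_proper : 1 \notin ideal_span tensalg_rel.
Proof.
apply/negP => /(@weight_ext_ker k^o 0 (fun _ => 1)) e.
have /e/eqP : @multilinear k V k^o 0 (fun _ => 1) by [].
rewrite -fword1 fword_extE /weight_ext /=.
by rewrite oner_eq0.
Qed.

Definition tensalg_ideal : proper_ideal (freealg V) :=
  ProperIdeal (@ideal_span_mul _ _ tensalg_rel) tensalg_proper.

Definition tensalg : Type := quoalg tensalg_ideal.
HB.instance Definition _ := GRing.Algebra.on tensalg.

Definition tgen (v : V) : tensalg := quoalg_pi tensalg_ideal (fword [:: v]).
Definition tword (s : seq V) : tensalg := \prod_(v <- s) tgen v.

Lemma twordE s : tword s = quoalg_pi tensalg_ideal (fword s).
Proof.
rewrite /tword; elim: s => [|v s IH]; last first.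
  by rewrite big_cons IH -rmorphM -fwordM.
by rewrite big_nil fword1 rmorph1.
Qed.

Lemma tensalg_ind (P : tensalg -> Prop) : P 0 ->
  (forall c s x, P x -> P (c *: tword s + x)) -> forall x, P x.
Proof.
move=> P0 PD; elim/quoalg_ind; elim/freealg_ind => [|c s x IH].
  by rewrite linear0.
by rewrite linearP /= -twordE; apply: PD.
Qed.

Lemma twordM (s t : seq V) : tword (s ++ t) = tword s * tword t.
Proof. exact: big_cat. Qed.

(* $V^{\otimes n}$, as the subspace of $T(V)$ spanned by the $x_1 \ldots x_n$. *)
Definition tpow (n : nat) : {pred tensalg} :=
  lspan (fun w => exists s : seq V, size s = n /\ w = tword s).
HB.instance Definition _ n := GRing.SubmodClosed.on (tpow n).

Section WordExtension.
Variables (F : lmodType k) (n : nat) (g : seq V -> F).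

(* For [g] multilinear, the linear map on $T(V)$ sending $x_1 \ldots x_n$ to
   [g [:: x_1; ...; x_n]] and vanishing on the other weights. *)
Definition word_ext (w : tensalg) : F := fword_ext (weight_ext n g) (quo_repr w).

Hypothesis g_mult : multilinear n g.

Lemma word_ext_linear : linear word_ext.
Proof.
by apply: quo_lift_linear; [exact: linearP | exact: weight_ext_ker].
Qed.

Lemma word_ext_word s : word_ext (tword s) = weight_ext n g s.
Proof.
rewrite twordE /word_ext quo_liftE; first exact: fword_extE.
  exact: linearP.
exact: weight_ext_ker.
Qed.
End WordExtension.

End TensorAlgebra.

Arguments tensalg {k} V.
Arguments tpow {k} V n.

Section Retraction.
Variables (k : fieldType) (E : lmodType k).

Definition is_retraction (S : submodClosed E) (g : E -> E) :=
  [/\ linear g, forall x, g x \in S & forall x, x \in S -> g x = x].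

Lemma complement_ex (S : submodClosed E) : exists C : E -> Prop,
  [/\ C 0, forall c x y, C x -> C y -> C (c *: x + y),
      forall x, C x -> x \in S -> x = 0 &
      forall x, exists s, s \in S /\ C (x - s)].
Proof.
pose P (C : set E) := (forall c x y, C x -> C y -> C (c *: x + y)) /\
                      (forall x, C x -> x \in S -> x = 0).
have [F FP Ftot|C [[CD CS] Cmax]] := @Zorn_bigcup E P.
  split=> [c x y [X FX Xx] [Y FY Yy]|x [X /FP[_ XS] Xx]]; last exact: XS.
  have [XY|YX] := Ftot X Y FX FY.
    by exists Y => //; apply: (FP Y FY).1 => //; apply: XY.
  by exists X => //; apply: (FP X FX).1 => //; apply: YX.
have C0 : C 0.
  case: (pselect (exists x, C x)) => [[x Cx]|nC].
    by have := CD (-1) x x Cx Cx; rewrite scaleN1r addNr.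
  exfalso; apply: (Cmax (fun x => x = 0)).
    split=> [x Cx|e]; first by case: nC; exists x.
    by apply: nC; exists 0; apply: e.
  by split=> [c x y -> ->|x -> //]; rewrite scaler0 addr0.
exists C; split=> // x; apply: contrapT => nx.
pose D y := exists c a, C a /\ y = c *: x + a.
apply: (Cmax D).
  split=> [y Cy|DC]; first by exists 0, y; rewrite scale0r add0r.
  apply: nx; exists 0; split; first exact: rpred0.
  by rewrite subr0; apply: DC; exists 1, 0; rewrite scale1r addr0.
split=> [c _ _ [d [a [Ca ->]]] [e [b [Cb ->]]]|_ [c [a [Ca ->]]] xaS].
  exists (c * d + e), (c *: a + b); split; first exact: CD.
  by rewrite scalerDr scalerA scalerDl addrACA.
have [c0|c0] := eqVneq c 0.
  by move: xaS; rewrite c0 scale0r add0r => /(CS _ Ca).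
exfalso; apply: nx; exists (c^-1 *: (c *: x + a)); split; first exact: rpredZ.
rewrite scalerDr scalerA mulVf // scale1r opprD addNKr -scaleNr.
by have := CD (- c^-1) a 0 Ca C0; rewrite addr0.
Qed.

Lemma retraction_ex (S : submodClosed E) : exists g, is_retraction S g.
Proof.
have [C [C0 CD CS Cx]] := complement_ex S.
have [g gP] := choice Cx; exists g.
have uniq x s : s \in S -> C (x - s) -> s = g x.
  move=> sS Cs; have [gS Cg] := gP x; apply/eqP; rewrite -subr_eq0; apply/eqP/CS.
    have := CD (-1) _ _ Cs Cg; rewrite scaleN1r opprB addrA subrK.
    by [].
  exact: submodB.
split=> [c x y|x|x xS]; last 2 first.
- exact: (gP x).1.
- by apply/esym/uniq => //; rewrite subrr.
apply/esym/uniq; first by apply: rpredD; [apply: rpredZ|]; exact: (gP _).1.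
rewrite opprD addrACA -scalerBr; apply: CD; exact: (gP _).2.
Qed.

Definition retraction (S : submodClosed E) : E -> E :=
  projT1 (cid (retraction_ex S)).

Lemma retractionP (S : submodClosed E) : is_retraction S (retraction S).
Proof. exact: projT2 (cid (retraction_ex S)). Qed.

End Retraction.

(* A left module over $A \otimes_k A^{op}$: the two actions commute and induce the
   same action of [k]. *)
Record bimodule (k : fieldType) (A : algType k) := Bimodule {
  bimod_space :> lmodType k;
  lact : A -> bimod_space -> bimod_space;
  ract : bimod_space -> A -> bimod_space;
  lact_bilin : bilin lact;
  ract_bilin : bilin ract;
  lact1 : forall m, lact 1 m = m;
  lactM : forall a b m, lact (a * b) m = lact a (lact b m);
  ract1 : forall m, ract m 1 = m;
  ractM : forall a b m, ract m (a * b) = ract (ract m a) b;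
  lractA : forall a m b, ract (lact a m) b = lact a (ract m b) }.

Notation "a *> m" := (lact a m) (at level 40, left associativity) : ring_scope.
Notation "m <* a" := (ract m a) (at level 40, left associativity) : ring_scope.

Section TensorOverAlgebra.
Variables (k : fieldType) (A : algType k) (P M : bimodule A).

(* $P \otimes_A M$ *)
Inductive balanced_rel : tens P M -> Prop :=
| BalancedRel p a m : balanced_rel (tpure (p <* a) m - tpure p (a *> m)).

Definition tensA_space : Type := quo (lspan balanced_rel).
HB.instance Definition _ := GRing.Lmodule.on tensA_space.

Definition tensA_pure (p : P) (m : M) : tensA_space :=
  quo_pi (lspan balanced_rel) (tpure p m).

Lemma tensA_pure_bilin : bilin tensA_pure.
Proof.
have [tl tr] := tpure_bilin P M.
by split=> [m c p p'|p c m m']; rewrite /tensA_pure ?(tl, tr) linearP.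
Qed.

Lemma tensA_balanced p a m : tensA_pure (p <* a) m = tensA_pure p (a *> m).
Proof.
by apply/eqP; rewrite -subr_eq0 -linearB; apply/eqP/quo_pi_eq0/mem_lspan.
Qed.

Section Lift.
Variables (F : lmodType k) (phi : P -> M -> F).

Definition tensA_lift (z : tensA_space) : F := tlift phi (quo_repr z).

Hypotheses (phiP : bilin phi) (phiA : forall p a m, phi (p <* a) m = phi p (a *> m)).

Lemma tensA_lift_ker x : x \in lspan balanced_rel -> tlift phi x = 0.
Proof.
apply: lspan_ker => [|_ [p a m]]; first exact: tlift_linear.
rewrite addrC -scaleN1r (tlift_linear phiP) !tlift_pure // phiA.
by rewrite scaleN1r addNr.
Qed.

Lemma tensA_lift_linear : linear tensA_lift.
Proof.
by apply: quo_lift_linear; [exact: tlift_linear | exact: tensA_lift_ker].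
Qed.

Lemma tensA_lift_pure p m : tensA_lift (tensA_pure p m) = phi p m.
Proof.
rewrite /tensA_lift quo_liftE ?tlift_pure //; first exact: tlift_linear.
exact: tensA_lift_ker.
Qed.
End Lift.

Lemma tensA_eq (F : lmodType k) (g h : tensA_space -> F) : linear g -> linear h ->
  (forall p m, g (tensA_pure p m) = h (tensA_pure p m)) -> g =1 h.
Proof.
move=> gl hl gh; elim/quo_ind; elim/tens_ind => [|p m z IH].
  rewrite linear0.
  have z0 (f : tensA_space -> F) : linear f -> f 0 = 0.
    by move=> fl; have := fl (-1) 0 0; rewrite scaler0 addr0 scaleN1r addNr.
  by rewrite !z0.
by rewrite linearD /= -[quo_pi _ _]scale1r gl hl -/(tensA_pure p m) gh IH.
Qed.

Definition tensA_lact (a : A) : tensA_space -> tensA_space :=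
  tensA_lift (fun p m => tensA_pure (a *> p) m).
Definition tensA_ract (z : tensA_space) (a : A) : tensA_space :=
  tensA_lift (fun p m => tensA_pure p (m <* a)) z.

Lemma bilin_lact a : bilin (fun p m => tensA_pure (a *> p) m).
Proof.
have [tl tr] := tensA_pure_bilin.
by split=> [m c p p'|p c m m']; rewrite ?(lact_bilin P).2 ?(tl, tr).
Qed.
Lemma bilin_ract a : bilin (fun p m => tensA_pure p (m <* a)).
Proof.
have [tl tr] := tensA_pure_bilin.
by split=> [m c p p'|p c m m']; rewrite ?(ract_bilin M).1 ?(tl, tr).
Qed.
Lemma balanced_lact b p a m :
  tensA_pure (b *> (p <* a)) m = tensA_pure (b *> p) (a *> m).
Proof. by rewrite -lractA tensA_balanced. Qed.
Lemma balanced_ract b p a m :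
  tensA_pure (p <* a) (m <* b) = tensA_pure p (a *> m <* b).
Proof. by rewrite lractA tensA_balanced. Qed.

Lemma tensA_lact_linear a : linear (tensA_lact a).
Proof. exact: tensA_lift_linear (bilin_lact a) (balanced_lact a). Qed.
Lemma tensA_ract_linear a : linear (tensA_ract^~ a).
Proof. exact: tensA_lift_linear (bilin_ract a) (balanced_ract a). Qed.
Lemma tensA_lactE a p m : tensA_lact a (tensA_pure p m) = tensA_pure (a *> p) m.
Proof. exact: tensA_lift_pure (bilin_lact a) (balanced_lact a) _ _. Qed.
Lemma tensA_ractE a p m : tensA_ract (tensA_pure p m) a = tensA_pure p (m <* a).
Proof. exact: tensA_lift_pure (bilin_ract a) (balanced_ract a) _ _. Qed.

Lemma linear_comp_gen (U W X : lmodType k) (g : W -> X) (h : U -> W) :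
  linear g -> linear h -> linear (g \o h).
Proof. by move=> gl hl c x y; rewrite /= hl gl. Qed.

Lemma linear_comb_gen (U W : lmodType k) c (g h : U -> W) :
  linear g -> linear h -> linear (fun x => c *: g x + h x).
Proof.
move=> gl hl d x y; rewrite gl hl !scalerDr !scalerA mulrC addrACA.
by rewrite -scalerA.
Qed.

Lemma tensA_lact_bilin : bilin tensA_lact.
Proof.
split=> [z c a b|]; last exact: tensA_lact_linear.
move: z; apply: tensA_eq => [||p m].
- exact: tensA_lact_linear.
- by apply: linear_comb_gen; exact: tensA_lact_linear.
- by rewrite !tensA_lactE (lact_bilin P).1 tensA_pure_bilin.1.
Qed.

Lemma tensA_ract_bilin : bilin tensA_ract.
Proof.
split=> [|z c a b]; first exact: tensA_ract_linear.
move: z; apply: tensA_eq => [||p m].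
- exact: tensA_ract_linear.
- by apply: linear_comb_gen; exact: tensA_ract_linear.
- by rewrite !tensA_ractE (ract_bilin M).2 tensA_pure_bilin.2.
Qed.

Lemma tensA_lact1 z : tensA_lact 1 z = z.
Proof.
move: z; apply: (tensA_eq (h := id)) => [||p m] //.
  exact: tensA_lact_linear.
by rewrite tensA_lactE lact1.
Qed.

Lemma tensA_ract1 z : tensA_ract z 1 = z.
Proof.
move: z; apply: (tensA_eq (h := id)) => [||p m] //.
  exact: tensA_ract_linear.
by rewrite tensA_ractE ract1.
Qed.

Lemma tensA_lactM a b z : tensA_lact (a * b) z = tensA_lact a (tensA_lact b z).
Proof.
move: z; apply: tensA_eq => [||p m]; first exact: tensA_lact_linear.
  by apply: linear_comp_gen; exact: tensA_lact_linear.
by rewrite !tensA_lactE lactM.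
Qed.

Lemma tensA_ractM a b z : tensA_ract z (a * b) = tensA_ract (tensA_ract z a) b.
Proof.
move: z; apply: tensA_eq => [||p m]; first exact: tensA_ract_linear.
  by apply: (linear_comp_gen (tensA_ract_linear b)); exact: tensA_ract_linear.
by rewrite !tensA_ractE ractM.
Qed.

Lemma tensA_lractA a z b :
  tensA_ract (tensA_lact a z) b = tensA_lact a (tensA_ract z b).
Proof.
move: z; apply: tensA_eq => [||p m].
- by apply: (linear_comp_gen (tensA_ract_linear b)); exact: tensA_lact_linear.
- by apply: linear_comp_gen; [exact: tensA_lact_linear|exact: tensA_ract_linear].
- by rewrite tensA_lactE !tensA_ractE tensA_lactE.
Qed.

Definition tensA : bimodule A := Bimodule tensA_lact_bilin tensA_ract_bilin
  tensA_lact1 tensA_lactM tensA_ract1 tensA_ractM tensA_lractA.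

Definition tpureA (p : P) (m : M) : tensA := tensA_pure p m.

Lemma tpureA_bilin : bilin tpureA.
Proof. exact: tensA_pure_bilin. Qed.
Lemma tpureA_balanced p a m : tpureA (p <* a) m = tpureA p (a *> m).
Proof. exact: tensA_balanced. Qed.
Lemma lact_tpureA a p m : a *> tpureA p m = tpureA (a *> p) m.
Proof. exact: tensA_lactE. Qed.
Lemma ract_tpureA p m a : tpureA p m <* a = tpureA p (m <* a).
Proof. exact: tensA_ractE. Qed.

End TensorOverAlgebra.

Section MultilinearWords.
Variables (k : fieldType) (V : lmodType k).

(* [g] is linear in the letters at the positions in [D] (counted from 0) and
   does not depend on the other letters. *)
Definition linear_at (F : lmodType k) (D : pred nat) (g : seq V -> F) :=
  forall s t c v w,
    g (s ++ (c *: v + w) :: t) =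
    if D (size s) then c *: g (s ++ v :: t) + g (s ++ w :: t) else g (s ++ v :: t).

Lemma linear_atW (F : lmodType k) D n (g : seq V -> F) :
  linear_at D g -> (forall m, (m < n)%N -> D m) -> multilinear n g.
Proof.
move=> gD Dn s t c v w e; rewrite gD Dn //.
by rewrite -e ltnS leq_addr.
Qed.

Lemma linear_at_comp (F G : lmodType k) D (g : seq V -> F) (h : F -> G) :
  linear h -> linear_at D g -> linear_at D (h \o g).
Proof. by move=> hl gD s t c v w; rewrite /= gD; case: ifP => // _; rewrite hl. Qed.

Lemma linear_at_const (F : lmodType k) D (g : seq V -> F) :
  linear_at D g ->
  forall s t v w, ~~ D (size s) -> g (s ++ v :: t) = g (s ++ w :: t).
Proof.
move=> gD s t v w nD.
by have := gD s t 1 (v - w) w; rewrite scale1r subrK (negbTE nD) => ->;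
   have := gD s t 0 (v - w) w; rewrite scale0r add0r (negbTE nD) => ->.
Qed.

Lemma linear_at_bilin (F G H : lmodType k) D1 D2 (phi : F -> G -> H) g1 g2 :
  bilin phi -> linear_at D1 g1 -> linear_at D2 g2 ->
  (forall n, D1 n -> D2 n -> False) ->
  linear_at (fun n => D1 n || D2 n) (fun x => phi (g1 x) (g2 x)).
Proof.
move=> [pl pr] g1D g2D D12 s t c v w; have := @D12 (size s).
case E1: (D1 _); case E2: (D2 _) => // dj; first by case: dj.
- rewrite g1D E1 pl; congr (_ *: phi _ _ + phi _ _).
    by apply: (linear_at_const g2D); rewrite E2.
  by apply: (linear_at_const g2D); rewrite E2.
- rewrite g2D E2 pr; congr (_ *: phi _ _ + phi _ _).
    by apply: (linear_at_const g1D); rewrite E1.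
  by apply: (linear_at_const g1D); rewrite E1.
- by rewrite g1D g2D E1 E2.
Qed.

Lemma multilinearD (F : lmodType k) n (g h : seq V -> F) :
  multilinear n g -> multilinear n h -> multilinear n (fun x => g x + h x).
Proof. by move=> gm hm s t c v w e; rewrite gm ?hm // scalerDr addrACA. Qed.

Lemma multilinearZ (F : lmodType k) n a (g : seq V -> F) :
  multilinear n g -> multilinear n (fun x => a *: g x).
Proof.
by move=> gm s t c v w e; rewrite gm // scalerDr !scalerA mulrC.
Qed.

Lemma multilinearN (F : lmodType k) n (g : seq V -> F) :
  multilinear n g -> multilinear n (fun x => - g x).
Proof. by move=> gm s t c v w e; rewrite gm // opprD scalerN. Qed.

Lemma multilinear_sum (F : lmodType k) n I (r : seq I) (P : pred I)
    (g : I -> seq V -> F) : (forall i, P i -> multilinear n (g i)) ->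
  multilinear n (fun x => \sum_(i <- r | P i) g i x).
Proof.
move=> gm s t c v w e; rewrite scaler_sumr -big_split /=.
by apply: eq_bigr => i Pi; rewrite gm.
Qed.

Lemma prod_linear_at (E : algType k) (u : V -> E) :
  linear u -> linear_at predT (fun x => \prod_(v <- x) u v).
Proof.
move=> ul s t c v w; rewrite !big_cat !big_cons /= ul.
by rewrite mulrDl mulrDr -scalerAl -scalerAr.
Qed.

Lemma tgen_linear : linear (@tgen k V).
Proof.
move=> c v w; apply/eqP; rewrite -subr_eq0 /tgen -linearP -linearB; apply/eqP.
exact/quo_pi_eq0/mem_ideal_span/TensalgRel.
Qed.

Lemma tword_linear_at : linear_at predT (@tword k V).
Proof. exact: prod_linear_at tgen_linear. Qed.

(* $x_i \ldots x_j$, with the letters counted from 1. *)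
Definition slice (x : seq V) (i j : nat) : seq V := take (j.+1 - i) (drop i.-1 x).

Lemma slice_linear_at i j :
  linear_at (fun n => (i.-1 <= n < i.-1 + (j.+1 - i))%N)
    (fun x => tword (slice x i j)).
Proof.
move=> s t c v w; rewrite /slice; move: (i.-1) (j.+1 - i)%N => a b.
case: (leqP a (size s)) => sa /=; last first.
  have E y : drop a (s ++ y :: t) = drop (a - size s).-1 t.
    rewrite drop_cat ltnNge ltnW //=.
    by case: (a - size s)%N (subn_gt0 (size s) a) => [|//]; rewrite sa.
  by rewrite !E.
have E y : drop a (s ++ y :: t) = drop a s ++ y :: t.
  rewrite drop_cat; case: ltngtP sa => // -> _.
  by rewrite subnn drop0 drop_size.
rewrite !E !take_cat size_drop; case: (ltnP b (size s - a)) => bs.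
  by case: (ltnP (size s) (a + b)) => // sab; exfalso; lia.
case: (ltnP (size s) (a + b)) => sab.
  have -> : (b - (size s - a))%N = (b - (size s - a)).-1.+1 by lia.
  exact: tword_linear_at.
by have -> : (b - (size s - a))%N = 0%N by lia.
Qed.

End MultilinearWords.

(* The data of an $N$-homogeneous algebra: $N \ge 2$ and $R \subseteq V^{\otimes N}$. *)
Record homog_rel (k : fieldType) (V : lmodType k) (N : nat) := HomogRel {
  rel_space :> submodClosed (tensalg V);
  rel_degree : (2 <= N)%N;
  rel_homog : {subset rel_space <= tpow V N} }.

Section HomogeneousAlgebra.
Variables (k : fieldType) (V : lmodType k) (N : nat) (R : homog_rel V N).

Lemma relations_word_ext0 (h : {linear tensalg V -> k^o}) a y b :
  (forall s, h (tword s) = if size s == 0%N then 1 else 0) ->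
  y \in R -> h (a * y * b) = 0.
Proof.
move=> hw /rel_homog Ry; apply: (linear_sandwich (u := @tword k V)) => [P P0 PD|s t].
  exact: tensalg_ind.
have [n nE] : exists n, N = n.+1.
  by exists N.-1; rewrite prednK //; apply: leq_trans (rel_degree R).
elim/lspan_ind: Ry => [|c _ z [r [rN ->]] IH].
  by rewrite mulr0 mul0r linear0.
rewrite mulrDr mulrDl -scalerAr -scalerAl linearP IH addr0.
rewrite -(twordM s) -(twordM _ t) hw !size_cat rN.
by rewrite nE addnS addSn /= scaler0.
Qed.

Lemma homog_ideal_proper : 1 \notin ideal_span (fun x => x \in R).
Proof.
have g_mult : @multilinear k V k^o 0 (fun _ => 1) by [].
have [h hw] : exists h : {linear tensalg V -> k^o},
    forall s, h (tword s) = if size s == 0%N then 1 else 0.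
  pose g (w : tensalg V) : k^o := word_ext 0 (fun _ => 1) w.
  have gl : linear g := word_ext_linear g_mult.
  pose gL := GRing.isLinear.Build k (tensalg V) k^o *:%R g gl.
  pose G : {linear tensalg V -> k^o} := HB.pack g gL.
  by exists G => s; exact: word_ext_word.
apply/negP => /(lspan_ker (linearP h)) h1.
have /eqP : h 1 = 0.
  by apply: h1 => _ [a [y [b [Ry ->]]]]; exact: relations_word_ext0.
have := hw [::]; rewrite /tword big_nil /= => ->.
by rewrite oner_eq0.
Qed.

Definition homog_ideal : proper_ideal (tensalg V) :=
  ProperIdeal (@ideal_span_mul _ _ (fun x => x \in R)) homog_ideal_proper.

(* $A = T(V)/(R)$ *)
Definition homalg : Type := quoalg homog_ideal.
HB.instance Definition _ := GRing.Algebra.on homalg.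

(* $W_p$, where $V^{\otimes i} \otimes R \otimes V^{\otimes j}$ is the product of
   subspaces of $T(V)$; for $p < N$ the intersection is $V^{\otimes p}$. *)
Definition koszulW_pred (p : nat) : {pred tensalg V} := fun w =>
  (w \in tpow V p) && `[< forall i j, (i + N + j)%N = p ->
    w \in lspan (fun y => exists a r b,
      [/\ a \in tpow V i, r \in R, b \in tpow V j & y = a * r * b]) >].

Lemma koszulW_closed p : submod_closed (koszulW_pred p).
Proof.
split=> [|c x y /andP[xp /asboolP xR] /andP[yp /asboolP yR]]; apply/andP; split.
- exact: rpred0.
- by apply/asboolP => i j _; exact: rpred0.
- by apply: rpredD => //; apply: rpredZ.
- apply/asboolP => i j e; apply: rpredD; last exact: yR.
  by apply: rpredZ; exact: xR.
Qed.

HB.instance Definition _ p :=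
  GRing.isSubmodClosed.Build k (tensalg V) (koszulW_pred p) (koszulW_closed p).

Record koszulW (p : nat) : Type := KoszulW {
  koszulW_val : tensalg V;
  koszulW_valP : koszulW_val \in koszulW_pred p }.

HB.instance Definition _ p := [isSub for @koszulW_val p].
HB.instance Definition _ p := [Choice of koszulW p by <:].
HB.instance Definition _ p := [SubChoice_isSubLmodule of koszulW p by <:].

(* A linear retraction of $T(V)$ onto $W_p$.  It makes [wfac r x i j] below
   meaningful for a single word [x], where the factor $x_i \ldots x_j$ need not be
   in $W_r$.  Every formula below is evaluated on linear combinations of words
   lying in some $W_n \subseteq V^{\otimes a} \otimes W_r \otimes V^{\otimes b}$.
   On this subspace the retraction acts on the middle factor as the identity, so
   the result does not depend on its choice. *)
Definition koszulW_proj (p : nat) (w : tensalg V) : koszulW p :=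
  let: And3 _ mem _ := retractionP (koszulW_pred p) in KoszulW (mem w).

Lemma koszulW_proj_linear p : linear (koszulW_proj p).
Proof.
move=> c x y; apply: val_inj; rewrite linearP /= /koszulW_proj.
by case: (retractionP _) => gl mem _ /=; rewrite gl.
Qed.

Lemma koszulW_projK p (w : koszulW p) : koszulW_proj p (val w) = w.
Proof.
apply: val_inj; rewrite /koszulW_proj; case: (retractionP _) => _ mem /= -> //.
exact: valP.
Qed.

(* $x_i \ldots x_j$ as an element of $A$, resp. of $W_r$, $r = j - i + 1$. *)
Definition afac (x : seq V) (i j : nat) : homalg :=
  quoalg_pi homog_ideal (tword (slice x i j)).

Definition wfac (r : nat) (x : seq V) (i j : nat) : koszulW r :=
  koszulW_proj r (tword (slice x i j)).

Lemma afac_linear_at i j :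
  linear_at (fun n => (i.-1 <= n < i.-1 + (j.+1 - i))%N) (fun x => afac x i j).
Proof. by apply: linear_at_comp (slice_linear_at i j); exact: linearP. Qed.

Lemma wfac_linear_at r i j :
  linear_at (fun n => (i.-1 <= n < i.-1 + (j.+1 - i))%N) (fun x => wfac r x i j).
Proof.
by apply: linear_at_comp (slice_linear_at i j); exact: koszulW_proj_linear.
Qed.

Lemma linear_at_eq (F : lmodType k) (D D' : pred nat) (g : seq V -> F) :
  D =1 D' -> linear_at D g -> linear_at D' g.
Proof. by move=> DD gD s t c v w; rewrite gD DD. Qed.

Lemma afac_on u v i j : i = u.+1 -> j = v -> (u <= v)%N ->
  linear_at (fun n => (u <= n < v)%N) (fun x => afac x i j).
Proof.
move=> -> -> uv; apply: linear_at_eq (afac_linear_at u.+1 v) => n /=.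
by rewrite subSS subnKC.
Qed.

Lemma wfac_on r u v i j : i = u.+1 -> j = v -> (u <= v)%N ->
  linear_at (fun n => (u <= n < v)%N) (fun x => wfac r x i j).
Proof.
move=> -> -> uv; apply: linear_at_eq (wfac_linear_at r u.+1 v) => n /=.
by rewrite subSS subnKC.
Qed.

Definition nu (p : nat) : nat := (N * p./2 + odd p)%N.

Definition cochain (M : bimodule homalg) (p : nat) : Type :=
  {linear koszulW (nu p) -> M}.

Definition chain (M : bimodule homalg) (q : nat) : Type := tens M (koszulW (nu q)).
HB.instance Definition _ M q := GRing.Lmodule.on (chain M q).

Section CochainDifferential.
Variables (M : bimodule homalg) (p : nat) (f : cochain M p).

Definition bK_cochain_word (x : seq V) : M :=
  let p' := p./2 in
  if odd p then
    \sum_(i < N) (afac x 1 i *> f (wfac (nu p) x (i + 1) (i + N * p' + 1))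
                    <* afac x (i + N * p' + 2) (N * p' + N))
  else
    f (wfac (nu p) x 1 (N * p')) <* afac x (N * p' + 1) (N * p' + 1)
    - afac x 1 1 *> f (wfac (nu p) x 2 (N * p' + 1)).

Lemma cochain_linear_at i j :
  linear_at (fun n => (i.-1 <= n < i.-1 + (j.+1 - i))%N)
    (fun x => f (wfac (nu p) x i j)).
Proof. exact: linear_at_comp (linearP f) (wfac_linear_at (nu p) i j). Qed.

Lemma cochain_on u v i j : i = u.+1 -> j = v -> (u <= v)%N ->
  linear_at (fun n => (u <= n < v)%N) (fun x => f (wfac (nu p) x i j)).
Proof. by move=> *; apply: (linear_at_comp (linearP f)); exact: wfac_on. Qed.

Lemma bK_cochain_word_mult : multilinear (nu p.+1) bK_cochain_word.
Proof.
rewrite /bK_cochain_word {1}/nu /= uphalf_half.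
have fl := cochain_linear_at; have al := afac_linear_at.
have := rel_degree R; move: (p./2) => p' N2.
case: (odd p) => /=.
  apply: multilinear_sum => i _; apply: linear_atW.
    apply: (linear_at_bilin (ract_bilin M)); [|exact: al|].
      by apply: (linear_at_bilin (lact_bilin M)) => //= n; lia.
    by move=> n /=; lia.
  by have := ltn_ord i => iN n /=; lia.
apply: multilinearD; last apply: multilinearN.
  apply: linear_atW.
    by apply: (linear_at_bilin (ract_bilin M)) => //= n; lia.
  by move=> n /=; lia.
apply: linear_atW.
  by apply: (linear_at_bilin (lact_bilin M)) => //= n; lia.
by move=> n /=; lia.
Qed.

Definition bK_cochain_fun (w : koszulW (nu p.+1)) : M :=
  word_ext (nu p.+1) bK_cochain_word (val w).

Lemma bK_cochain_linear : linear bK_cochain_fun.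
Proof.
move=> c v w; rewrite /bK_cochain_fun linearP.
exact: word_ext_linear bK_cochain_word_mult _ _ _.
Qed.

HB.instance Definition _ := GRing.isLinear.Build k (koszulW (nu p.+1)) M *:%R
  bK_cochain_fun bK_cochain_linear.

Definition bK_cochain : cochain M p.+1 := bK_cochain_fun.

End CochainDifferential.

Section ChainExtension.
Variables (M : bimodule homalg) (q : nat) (F : lmodType k) (g : M -> seq V -> F).

(* The linear map given by [g m [:: x_1; ...; x_n]], $n = \nu(q)$, on
   $m \otimes x_1 \ldots x_n$. *)
Definition chain_ext (z : chain M q) : F :=
  tlift (fun m (w : koszulW (nu q)) => word_ext (nu q) (g m) (val w)) z.

Hypothesis g_mult : forall m, multilinear (nu q) (g m).
Hypothesis g_lin : forall x, linear (g^~ x).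

Lemma chain_ext_bilin :
  bilin (fun m (w : koszulW (nu q)) => word_ext (nu q) (g m) (val w)).
Proof.
split=> [w c m m'|m c v w]; last first.
  by rewrite linearP; exact: word_ext_linear (g_mult m) _ _ _.
have w0 m0 : word_ext (nu q) (g m0) 0 = 0.
  have := word_ext_linear (g_mult m0) (-1) 0 0.
  by rewrite scaler0 addr0 scaleN1r addNr.
elim/tensalg_ind: (val w) => [|d s x IH]; first by rewrite !w0 scaler0 addr0.
have wl m0 := word_ext_linear (g_mult m0).
rewrite !wl IH !word_ext_word // /weight_ext.
case: ifP => _; last by rewrite !scaler0 !add0r.
by rewrite g_lin !scalerDr !scalerA mulrC addrACA.
Qed.

Lemma chain_ext_linear : linear chain_ext.
Proof. exact: tlift_linear chain_ext_bilin. Qed.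

End ChainExtension.

Section ChainDifferential.
Variables (M : bimodule homalg) (q : nat).

Definition bK_chain_word (m : M) (x : seq V) : chain M q.-1 :=
  let q' := q./2 in
  if odd q then
    tpure (m <* afac x 1 1) (wfac (nu q.-1) x 2 (N * q' + 1))
    - tpure (afac x (N * q' + 1) (N * q' + 1) *> m)
            (wfac (nu q.-1) x 1 (N * q'))
  else
    \sum_(i < N)
      tpure (afac x (i + N * q' - N + 2) (N * q') *> m <* afac x 1 i)
            (wfac (nu q.-1) x (i + 1) (i + N * q' - N + 1)).

(* Lands in degree [0.-1 = 0] instead of $-1$ for [q = 0], where it is zero. *)
Definition bK_chain (z : chain M q) : chain M q.-1 :=
  if q == 0%N then 0 else chain_ext bK_chain_word z.

Lemma const_linear_at (E : lmodType k) (e : E) : linear_at (V := V) pred0 (fun _ => e).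
Proof. by []. Qed.

Lemma bK_chain_word_mult m : (0 < q)%N -> multilinear (nu q) (bK_chain_word m).
Proof.
move=> q0; rewrite /bK_chain_word {1}/nu.
have wl r := wfac_linear_at r; have al := afac_linear_at.
have ml := const_linear_at m; have tb := tpure_bilin M (koszulW (nu q.-1)).
have := odd_double_half q; have := rel_degree R; move: (q./2) => q' N2.
case: (odd q) => /= qE.
  apply: multilinearD; last apply: multilinearN.
    apply: linear_atW.
      apply: (linear_at_bilin tb); [|exact: wl|].
        exact: (linear_at_bilin (ract_bilin M) ml (al _ _)).
      by move=> n /=; lia.
    by move=> n /=; lia.
  apply: linear_atW.
    apply: (linear_at_bilin tb); [|exact: wl|].
      by apply: (linear_at_bilin (lact_bilin M) (al _ _) ml) => n /=; lia.
    by move=> n /=; lia.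
  by move=> n /=; lia.
have [q1 qE1] : exists q1, q' = q1.+1 by exists q'.-1; lia.
rewrite qE1; apply: multilinear_sum => i _; have iN := ltn_ord i.
apply: linear_atW.
  apply: (linear_at_bilin tb); [|exact: wl|].
    apply: (linear_at_bilin (ract_bilin M)); [|exact: al|].
      by apply: (linear_at_bilin (lact_bilin M) (al _ _) ml) => n /=; lia.
    by move=> n /=; nia.
  by move=> n /=; nia.
by move=> n /=; nia.
Qed.

Lemma bK_chain_word_linear x : linear (bK_chain_word^~ x).
Proof.
move=> c m m'; rewrite /bK_chain_word.
have [tl _] := tpure_bilin M (koszulW (nu q.-1)).
case: ifP => _.
  rewrite (ract_bilin M).1 (lact_bilin M).2 !tl opprD scalerBr addrACA.
  by rewrite -scalerN.
rewrite scaler_sumr -big_split; apply: eq_bigr => i _ /=.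
by rewrite (lact_bilin M).2 (ract_bilin M).1 tl.
Qed.

Lemma bK_chain_linear : linear bK_chain.
Proof.
move=> c y z; rewrite /bK_chain; case: eqVneq => [_|q0].
  by rewrite scaler0 addr0.
apply: chain_ext_linear => [m|x]; last exact: bK_chain_word_linear.
by apply: bK_chain_word_mult; rewrite lt0n.
Qed.

End ChainDifferential.

Section CapProducts.
Variables (M P : bimodule homalg) (p q : nat) (f : cochain P p).

(* [capl] is $f \frown z$ and [capr] is $z \frown f$. *)
Definition capl_word (m : M) (x : seq V) : chain (tensA P M) (q - p) :=
  let p' := p./2 in let q' := q./2 in
  if odd p && ~~ odd q then
    - \sum_(i < N) \sum_(j < N | (i + j <= N - 2)%N)
        tpure
          (tpureA
             (afac x (N * q' - N * p' - N + i + 2) (N * q' - N * p' - j - 1)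
                *> f (wfac (nu p) x (N * q' - N * p' - j) (N * q' - j)))
             (afac x (N * q' - j + 1) (N * q') *> m <* afac x 1 i))
          (wfac (nu (q - p)) x (i + 1) (i + N * q' - N * p' - N + 1))
  else
    tpure (tpureA (f (wfac (nu p) x (nu (q - p) + 1) (nu q))) m)
          (wfac (nu (q - p)) x 1 (nu (q - p))).

Definition capr_word (m : M) (x : seq V) : chain (tensA M P) (q - p) :=
  let p' := p./2 in let q' := q./2 in
  if odd p && ~~ odd q then
    \sum_(i < N) \sum_(j < N | (i + j <= N - 2)%N)
      tpure
        (tpureA
           (afac x (N * q' - j + 1) (N * q') *> m <* afac x 1 i)
           (f (wfac (nu p) x (i + 1) (N * p' + i + 1))
              <* afac x (N * p' + i + 2) (N * p' + N - j - 1)))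
        (wfac (nu (q - p)) x (N * p' + N - j) (N * q' - j))
  else
    (-1) ^+ (p * q) *:
      tpure (tpureA m (f (wfac (nu p) x 1 (nu p))))
            (wfac (nu (q - p)) x (nu p + 1) (nu q)).

(* When [q < p] the degree [q - p] is [0], and the products are zero. *)
Definition capl (z : chain M q) : chain (tensA P M) (q - p) :=
  if (q < p)%N then 0 else chain_ext capl_word z.

Definition capr (z : chain M q) : chain (tensA M P) (q - p) :=
  if (q < p)%N then 0 else chain_ext capr_word z.

Lemma nuE_even a : odd a = false -> nu a = (N * a./2)%N.
Proof. by rewrite /nu => ->; rewrite addn0. Qed.

Lemma nu_sub : (p <= q)%N -> odd p && ~~ odd q = false -> (nu q = nu (q - p) + nu p)%N.
Proof.
move=> pq pqo; rewrite /nu.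
have -> : ((q - p)./2 = q./2 - p./2)%N by lia.
rewrite oddB //; have : (p./2 <= q./2)%N by lia.
move: pqo; case: (odd p); case: (odd q) => //= _ h; nia.
Qed.

Lemma capl_word_mult m : (p <= q)%N -> multilinear (nu q) (capl_word m).
Proof.
move=> pq; rewrite /capl_word.
have wl := wfac_linear_at (nu (q - p)); have al := afac_linear_at.
have fl := cochain_linear_at f.
have ml := const_linear_at m; have tb := tpure_bilin (tensA P M) (koszulW (nu (q - p))).
have ab := tpureA_bilin P M; have N2 := rel_degree R.
case E: (odd p && ~~ odd q); last first.
  have nuE := nu_sub pq E; apply: linear_atW.
    apply: (linear_at_bilin tb); [|exact: wl|].
      exact: (linear_at_bilin ab (fl _ _) ml).
    by move=> n /=; lia.
  by move=> n /=; lia.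
have [op oq] := andP E.
have [r qE] : exists r, q./2 = (p./2 + r.+1)%N.
  by exists (q./2 - p./2).-1; lia.
have -> : nu q = (N * q./2)%N by apply: nuE_even; apply: negbTE.
rewrite qE !mulnDr mulnS; move: (N * p./2)%N (N * r)%N => a b.
clear pq E op oq qE wl al fl.
apply: multilinearN; apply: multilinear_sum => i _.
apply: multilinear_sum => j ij.
have [e [NE ie]] : exists e, N = (e + j).+1 /\ (i < e)%N.
  by exists (N - j).-1; lia.
move: (nat_of_ord i) (nat_of_ord j) NE ie => {ij}i {}j NE ie.
apply: linear_atW.
  apply: (linear_at_bilin tb).
  - apply: (linear_at_bilin ab).
    + apply: (linear_at_bilin (lact_bilin P)).
      * by apply: (@afac_on (i + b).+1 (b + e)); lia.
      * by apply: (cochain_on f (u := b + e) (v := (a + b + e).+1)); lia.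
      * by move=> n /=; lia.
    + apply: (linear_at_bilin (ract_bilin M)).
      * apply: (linear_at_bilin (lact_bilin M)); [|exact: ml|by []].
        by apply: (@afac_on (a + b + e).+1 (a + (N + b))); lia.
      * by apply: (@afac_on 0 i); lia.
      * by move=> n /=; lia.
    + by move=> n /=; lia.
  - by apply: (@wfac_on _ i (i + b).+1); lia.
  - by move=> n /=; lia.
by move=> n /=; lia.
Qed.

Lemma capr_word_mult m : (p <= q)%N -> multilinear (nu q) (capr_word m).
Proof.
move=> pq; rewrite /capr_word.
have wl := wfac_linear_at (nu (q - p)); have al := afac_linear_at.
have fl := cochain_linear_at f.
have ml := const_linear_at m; have tb := tpure_bilin (tensA M P) (koszulW (nu (q - p))).
have ab := tpureA_bilin M P; have N2 := rel_degree R.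
case E: (odd p && ~~ odd q); last first.
  have nuE := nu_sub pq E; apply: multilinearZ; apply: linear_atW.
    apply: (linear_at_bilin tb); [|exact: wl|].
      by apply: (linear_at_bilin ab ml (fl _ _)) => n /=; lia.
    by move=> n /=; lia.
  by move=> n /=; lia.
have [op oq] := andP E.
have [r qE] : exists r, q./2 = (p./2 + r.+1)%N.
  by exists (q./2 - p./2).-1; lia.
have -> : nu q = (N * q./2)%N by apply: nuE_even; apply: negbTE.
rewrite qE !mulnDr mulnS; move: (N * p./2)%N (N * r)%N => a b.
clear pq E op oq qE wl al fl.
apply: multilinear_sum => i _; apply: multilinear_sum => j ij.
have [e [NE ie]] : exists e, N = (e + j).+1 /\ (i < e)%N.
  by exists (N - j).-1; lia.
move: (nat_of_ord i) (nat_of_ord j) NE ie => {ij}i {}j NE ie.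
apply: linear_atW.
  apply: (linear_at_bilin tb).
  - apply: (linear_at_bilin ab).
    + apply: (linear_at_bilin (ract_bilin M)).
      * apply: (linear_at_bilin (lact_bilin M)); [|exact: ml|by []].
        by apply: (@afac_on (a + b + e).+1 (a + (N + b))); lia.
      * by apply: (@afac_on 0 i); lia.
      * by move=> n /=; lia.
    + apply: (linear_at_bilin (ract_bilin P)).
      * by apply: (cochain_on f (u := i) (v := (i + a).+1)); lia.
      * by apply: (@afac_on (i + a).+1 (a + e)); lia.
      * by move=> n /=; lia.
    + by move=> n /=; lia.
  - by apply: (@wfac_on _ (a + e) (a + b + e).+1); lia.
  - by move=> n /=; lia.
by move=> n /=; lia.
Qed.

Lemma capl_word_linear x : linear (capl_word^~ x).
Proof.
move=> c m m'; rewrite /capl_word.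
have [tl _] := tpure_bilin (tensA P M) (koszulW (nu (q - p))).
have [_ ar] := tpureA_bilin P M.
case: (odd p && ~~ odd q); last by rewrite ar tl.
rewrite scalerN -opprD scaler_sumr -big_split; congr (- _).
apply: eq_bigr => i _; rewrite scaler_sumr -big_split; apply: eq_bigr => j _ /=.
by rewrite (lact_bilin M).2 (ract_bilin M).1 ar tl.
Qed.

Lemma capr_word_linear x : linear (capr_word^~ x).
Proof.
move=> c m m'; rewrite /capr_word.
have [tl _] := tpure_bilin (tensA M P) (koszulW (nu (q - p))).
have [al _] := tpureA_bilin M P.
case: (odd p && ~~ odd q); last by rewrite al tl scalerDr !scalerA mulrC.
rewrite scaler_sumr -big_split.
apply: eq_bigr => i _; rewrite scaler_sumr -big_split; apply: eq_bigr => j _ /=.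
by rewrite (lact_bilin M).2 (ract_bilin M).1 al tl.
Qed.

Lemma capl_linear : linear capl.
Proof.
move=> c y z; rewrite /capl; case: ltnP => [_|pq]; first by rewrite scaler0 addr0.
apply: chain_ext_linear => [m|x]; last exact: capl_word_linear.
exact: capl_word_mult.
Qed.

Lemma capr_linear : linear capr.
Proof.
move=> c y z; rewrite /capr; case: ltnP => [_|pq]; first by rewrite scaler0 addr0.
apply: chain_ext_linear => [m|x]; last exact: capr_word_linear.
exact: capr_word_mult.
Qed.

End CapProducts.

(* Identifies chains along an equality of degrees. *)
Definition chain_cast (M : bimodule homalg) (q q' : nat) (e : q = q')
  (z : chain M q) : chain M q' := ecast n (chain M n) e z.

End HomogeneousAlgebra.

(* Main.v *)
From HB Require Import structures.
Require Import Defs.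
From mathcomp Require Import all_boot all_algebra.
From mathcomp Require Import boolp zify.

(** The proof has two independent parts.

    On bare words.  Replace the cochain by an arbitrary function [phi] of words and
    the chain $m \otimes y$ by the value of an arbitrary function [h m y] that is
    linear in [m]; the differentials and the cap products become the operators
    [dchain], [dcochain], [lcap] and [rcap], and the Leibniz formulas become the
    identities [lcap_dchain] and [rcap_dchain] between functions of a word.  These
    follow from the bimodule axioms and the balancing of the tensor product over the
    algebra.  If [p] is even and [q] odd, every member of the identity has two terms
    and these match.  In the other parities exactly one of the three members of the
    identity is a sum over the triangle $i + j \le N - 2$ of terms involving a
    differential with two terms.  This differential replaces each of them by the
    difference of two neighbours in the larger triangle $i + j \le N - 1$.  The sum
    telescopes to two of the three sides of that triangle, and each of the two other
    members is the sum over one of these sides.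

    From words to the Koszul spaces.  In the operators a factor $x_i \ldots x_j$ of a
    word enters through a projection onto $W_r$, and a composite of two operators has
    such a projection in its middle.  It disappears on tensors in $W_n$ because
    $W_{a+r+b} \subseteq V^{\otimes a} \otimes W_r \otimes V^{\otimes b}$
    ([koszulW_split]).  To see this inclusion, contract a tensor $w \in W_{n+1}$ with a
    functional in its first or last letter: this gives an element of $W_n$, by the
    definition of $W$ as an intersection, and finitely many functionals suffice to
    recover [w] from its contractions.  The consequence [eqW_proj] identifies every
    composite of two operators on $m \otimes w$ with the composite of their formulas on
    bare words, so that the first part applies. *)

Set Implicit Arguments.
Unset Strict Implicit.
Unset Printing Implicit Defensive.

Import GRing.Theory.
Local Open Scope ring_scope.

(** * Linear maps given by a hypothesis *)

(** The differentials and the cap products are functions with a separate proof of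
    [linear], so the usual rules are stated for such functions. *)
Section LinearMaps.
Variables (k : fieldType) (E F : lmodType k) (g : E -> F).
Hypothesis gl : linear g.

Lemma lin0 : g 0 = 0.
Proof. by have := gl (-1) 0 0; rewrite scaler0 addr0 scaleN1r addNr. Qed.
Lemma linD x y : g (x + y) = g x + g y.
Proof. by have := gl 1 x y; rewrite !scale1r. Qed.
Lemma linZ c x : g (c *: x) = c *: g x.
Proof. by have := gl c x 0; rewrite !addr0 lin0 addr0. Qed.
Lemma linN x : g (- x) = - g x.
Proof. by rewrite -scaleN1r linZ scaleN1r. Qed.
Lemma linB x y : g (x - y) = g x - g y.
Proof. by rewrite linD linN. Qed.
Lemma lin_sum I (r : seq I) (Q : pred I) (u : I -> E) :
  g (\sum_(i <- r | Q i) u i) = \sum_(i <- r | Q i) g (u i).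
Proof. exact: (big_morph g linD lin0). Qed.

End LinearMaps.

Lemma linear_combr (k : fieldType) (E F : lmodType k) c (g h : E -> F) :
  linear g -> linear h -> linear (fun x => g x + c *: h x).
Proof.
by move=> gl hl d x y; rewrite gl hl !scalerDr !scalerA [c * d]mulrC addrACA.
Qed.

Lemma tens_eq (k : fieldType) (E F G : lmodType k) (g h : tens E F -> G) :
  linear g -> linear h ->
  (forall u v, g (tpure u v) = h (tpure u v)) -> g =1 h.
Proof.
move=> gl hl gh; elim/tens_ind => [|u v z IH]; first by rewrite (lin0 gl) (lin0 hl).
by rewrite (linD gl) (linD hl) gh IH.
Qed.

(** * Functions of words evaluated on tensors *)

(** These rules hold for every function of words, multilinear or not, because
    [word_ext] reads off the coefficients of one fixed representative in the free
    algebra. *)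
Section WordExt.
Variables (k : fieldType) (V : lmodType k) (n : nat).
Implicit Types (F G : lmodType k) (w : tensalg V).

Lemma eq_word_ext F (g g' : seq V -> F) :
  (forall x, size x = n -> g x = g' x) -> word_ext n g =1 word_ext n g'.
Proof.
move=> gg w; rewrite /word_ext; elim/freealg_ind: (quo_repr w) => [|c s x IH].
  by rewrite !linear0.
rewrite !linearP /= IH !fword_extE /weight_ext.
by case: eqP => // /gg ->.
Qed.

Lemma word_ext_comp F G (L : F -> G) (g : seq V -> F) w : linear L ->
  word_ext n (fun x => L (g x)) w = L (word_ext n g w).
Proof.
move=> Ll; rewrite /word_ext; elim/freealg_ind: (quo_repr w) => [|c s x IH].
  by rewrite !linear0 (lin0 Ll).
rewrite !linearP /= IH Ll !fword_extE /weight_ext.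
by case: eqP => // _; rewrite (lin0 Ll).
Qed.

Lemma word_ext_comb F c (g g' : seq V -> F) w :
  word_ext n (fun x => c *: g x + g' x) w = c *: word_ext n g w + word_ext n g' w.
Proof.
rewrite /word_ext; elim/freealg_ind: (quo_repr w) => [|d s x IH].
  by rewrite !linear0 addr0.
rewrite !fword_ext_linear IH !fword_extE /weight_ext scalerDr addrACA; congr (_ + _).
case: eqP => _; last by rewrite !scaler0 addr0.
by rewrite scalerDr !scalerA mulrC.
Qed.

Lemma word_ext0 F w : word_ext n (fun _ => 0 : F) w = 0.
Proof.
rewrite /word_ext; elim/freealg_ind: (quo_repr w) => [|c s x IH].
  by rewrite linear0.
by rewrite fword_ext_linear IH fword_extE /weight_ext if_same scaler0 addr0.
Qed.

Lemma word_extD F (g g' : seq V -> F) w :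
  word_ext n (fun x => g x + g' x) w = word_ext n g w + word_ext n g' w.
Proof.
rewrite -[X in _ = X + _]scale1r -word_ext_comb; apply: eq_word_ext => x _.
by rewrite scale1r.
Qed.

Lemma word_extZ F c (g : seq V -> F) w :
  word_ext n (fun x => c *: g x) w = c *: word_ext n g w.
Proof.
by apply: word_ext_comp => d x y; rewrite scalerDr !scalerA mulrC.
Qed.

Lemma word_ext_sum F I (r : seq I) (Q : pred I) (g : I -> seq V -> F) w :
  word_ext n (fun x => \sum_(i <- r | Q i) g i x) w =
  \sum_(i <- r | Q i) word_ext n (g i) w.
Proof.
elim: r => [|i r IH].
  rewrite big_nil -[RHS](word_ext0 F w).
  by apply: eq_word_ext => x _; rewrite big_nil.
rewrite big_cons -IH; case: ifP => Qi; last first.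
  by apply: eq_word_ext => x _; rewrite big_cons Qi.
by rewrite -word_extD; apply: eq_word_ext => x _; rewrite big_cons Qi.
Qed.

End WordExt.

(** * Splitting the Koszul spaces *)

Section DualSystem.
Variables (k : fieldType) (V : lmodType k).

(** A retraction onto the line of [v] gives the coordinate along [v]. *)
Lemma functional_ex (v : V) : v != 0 -> exists e : {linear V -> k^o}, e v = 1.
Proof.
move=> v0; pose S := lspan (fun y : V => y = v).
have SP y : y \in S -> exists c : k, y = c *: v.
  elim/lspan_ind => [|c _ z -> [d ->]]; first by exists 0; rewrite scale0r.
  by exists (c + d); rewrite scalerDl.
have [g [gl gS gK]] := retraction_ex S.
have [e eE] := choice (fun y => SP _ (gS y)).
have vI (c d : k) : c *: v = d *: v -> c = d.
  move/eqP; rewrite -subr_eq0 -scalerBl scaler_eq0 (negbTE v0) orbF subr_eq0.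
  by move/eqP.
have el : linear (e : V -> k^o).
  move=> c x y; apply: vI.
  by rewrite -eE gl [X in c *: X]eE [X in _ + X]eE scalerDl scalerA.
pose eL := GRing.isLinear.Build k V k^o *:%R e el.
pose e' : {linear V -> k^o} := HB.pack (e : V -> k^o) eL.
exists e'; apply: vI.
by rewrite -eE gK ?scale1r //; exact: mem_lspan.
Qed.

(** A finite substitute for a dual basis: an operator of finite rank fixing a given
    finite list of vectors.  If [P] fixes the vectors so far and [v] is new, then
    adding $u \mapsto e(u - P u) (v - P v)$ with $e(v - P v) = 1$ fixes [v] too. *)
Lemma dual_system (X : seq V) : exists ed : seq (V * {linear V -> k^o}),
  forall v, v \in X -> \sum_(a <- ed) (a.2 v : k) *: a.1 = v.
Proof.
elim: X => [|v X [ed eX]]; first by exists [::].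
pose P u := \sum_(a <- ed) (a.2 u : k) *: a.1.
have Pl : linear P.
  move=> c x y; rewrite /P scaler_sumr -big_split /=.
  by apply: eq_bigr => a _; rewrite linearP scalerDl scalerA.
have [v0|v0] := eqVneq (v - P v) 0.
  exists ed => u; rewrite inE => /orP[/eqP ->|/eX //].
  by move/eqP: v0; rewrite subr_eq0 => /eqP.
have [e ev] := functional_ex v0; pose d u := e (u - P u).
have dl : linear d.
  by move=> c x y; rewrite /d Pl -linearP scalerBr opprD addrACA.
pose dL := GRing.isLinear.Build k V k^o *:%R d dl.
pose d' : {linear V -> k^o} := HB.pack (d : V -> k^o) dL.
exists ((v - P v, d') :: ed) => u.
rewrite inE big_cons /= -/(P u) /d => /orP[/eqP ->|uX].
  by rewrite ev scale1r subrK.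
by rewrite [P u]eX // subrr linear0 scale0r add0r.
Qed.

End DualSystem.

Section TensorPowers.
Variables (k : fieldType) (V : lmodType k).

Lemma tword_tpow (s : seq V) : tword s \in tpow V (size s).
Proof. by apply: mem_lspan; exists s. Qed.

Lemma tpowM m n (x y : tensalg V) :
  x \in tpow V m -> y \in tpow V n -> x * y \in tpow V (m + n).
Proof.
move=> xm yn; elim/lspan_ind: xm => [|c _ x' [s [sm ->]] IH].
  by rewrite mul0r rpred0.
rewrite mulrDl; apply: rpredD => //; rewrite -scalerAl; apply: rpredZ.
elim/lspan_ind: yn => [|d _ y' [t [tn ->]] IH']; first by rewrite mulr0 rpred0.
rewrite mulrDr; apply: rpredD => //; rewrite -scalerAr; apply: rpredZ.
by rewrite -twordM -sm -tn -size_cat tword_tpow.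
Qed.

(** Only finitely many letters occur in a tensor; a linear map is thus controlled
    by its values on the words in these letters. *)
Lemma tpow_letters n (w : tensalg V) : w \in tpow V n ->
  exists X : seq V, forall (F : lmodType k) (g : tensalg V -> F), linear g ->
    (forall s, size s = n -> {subset s <= X} -> g (tword s) = 0) -> g w = 0.
Proof.
elim/lspan_ind => [|c _ y [s [sn ->]] [X XP]].
  by exists [::] => F g gl _; exact: lin0.
exists (s ++ X) => F g gl gX; rewrite gl gX // => [|u us].
  rewrite scaler0 add0r; apply: XP => // t tn tX; apply: gX => // u /tX.
  by rewrite mem_cat orbC => ->.
by rewrite mem_cat us.
Qed.

Lemma tpow_eq (F : lmodType k) n (g h : tensalg V -> F) : linear g -> linear h ->
  (forall s, size s = n -> g (tword s) = h (tword s)) ->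
  {in tpow V n, g =1 h}.
Proof.
move=> gl hl gh w; elim/lspan_ind => [|c _ y [s [/gh e ->]] IH].
  by rewrite (lin0 gl) (lin0 hl).
by rewrite gl hl e IH.
Qed.

End TensorPowers.

Section Splitting.
Variables (k : fieldType) (V : lmodType k) (N : nat) (R : homog_rel V N).
Local Notation W := (koszulW_pred R).

(** Contracting the outer letters against functionals sends
    $V^{\otimes (a+i)} \otimes R \otimes V^{\otimes (j+b)}$ into
    $V^{\otimes i} \otimes R \otimes V^{\otimes j}$, hence the intersection
    $W_{a+r+b}$ into $W_r$. *)
Lemma contraction_koszulW (C : tensalg V -> tensalg V) a r b
    (c : seq V -> seq V -> k) : linear C ->
  (forall s y t, size s = a -> y \in tpow V r -> size t = b ->
     C (tword s * y * tword t) = c s t *: y) ->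
  forall w, w \in W (a + r + b) -> C w \in W r.
Proof.
move=> Cl CE w /andP[wT /asboolP wR]; apply/andP; split.
  elim/lspan_ind: wT => [|d _ y [s [sn ->]] IH]; first by rewrite (lin0 Cl) rpred0.
  rewrite Cl; apply: rpredD => //; apply: rpredZ.
  rewrite -(cat_take_drop (a + r) s) twordM -(cat_take_drop a (take _ s)) twordM.
  have m_r : tword (drop a (take (a + r) s)) \in tpow V r.
    apply: mem_lspan; exists (drop a (take (a + r) s)); split=> //.
    by rewrite size_drop size_takel; lia.
  rewrite CE // ?size_drop ?size_takel; try lia.
  by apply: rpredZ.
apply/asboolP => i j e.
have /wR : (a + i + N + (j + b) = a + r + b)%N by lia.
elim/lspan_ind => [|d _ y [l [rho [m [lT rhoR mT ->]]]] IH].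
  by rewrite (lin0 Cl) rpred0.
rewrite Cl; apply: rpredD => //; apply: rpredZ.
elim/lspan_ind: lT => [|d' _ l' [s [ss ->]] IHl].
  by rewrite !mul0r (lin0 Cl) rpred0.
rewrite !mulrDl -!scalerAl Cl; apply: rpredD => //; apply: rpredZ.
elim/lspan_ind: mT => [|d'' _ m' [t [tt ->]] IHm].
  by rewrite !mulr0 (lin0 Cl) rpred0.
rewrite mulrDr -scalerAr Cl; apply: rpredD => //; apply: rpredZ.
rewrite -(cat_take_drop a s) -(cat_take_drop j t) !twordM.
have si : tword (drop a s) \in tpow V i.
  by apply: mem_lspan; exists (drop a s); rewrite size_drop ss; split=> //; lia.
have tj : tword (take j t) \in tpow V j.
  by apply: mem_lspan; exists (take j t); split=> //; rewrite size_takel //; lia.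
rewrite [X in C X](_ : _ = tword (take a s) *
    (tword (drop a s) * rho * tword (take j t)) * tword (drop j t)); last first.
  by rewrite !mulrA.
rewrite CE; first last.
- by rewrite size_drop; lia.
- by rewrite -e; apply: tpowM => //; apply: tpowM => //; exact: (@rel_homog _ _ _ R).
- by rewrite size_takel //; lia.
apply: rpredZ; apply: mem_lspan.
by exists (tword (drop a s)), rho, (tword (take j t)).
Qed.

(** With a dual system for the letters of [w], the tensor [w] is the sum of the
    products of each vector of the system and the contraction of [w] by the
    matching functional; [contraction_koszulW] puts the contractions in $W_n$. *)
Lemma koszulW_left n w : w \in W n.+1 ->
  w \in lspan (fun y => exists v u, u \in W n /\ y = tgen v * u).
Proof.
move=> wW; pose g (e : {linear V -> k^o}) (x : seq V) : tensalg V :=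
  if x is v :: s then (e v : k) *: tword s else 0.
have gm e : multilinear n.+1 (g e).
  move=> [|u s] t c v v' _ /=; last by rewrite tword_linear_at /= scalerDr !scalerA mulrC.
  by rewrite linearP scalerDl scalerA.
pose C e (y : tensalg V) := word_ext n.+1 (g e) y.
have Cl e : linear (C e) := word_ext_linear (gm e).
have CE e v y : y \in tpow V n -> C e (tgen v * y) = (e v : k) *: y.
  move: y; apply: tpow_eq => [c x y|c x y|s sn].
  - by rewrite mulrDr -scalerAr Cl.
  - by rewrite scalerDr !scalerA mulrC.
  have -> : tgen v * tword s = tword (v :: s) by rewrite /tword big_cons.
  by rewrite /C word_ext_word // /weight_ext /= sn eqxx.
have CW e : C e w \in W n.
  apply: (@contraction_koszulW (C e) 1 n 0 (fun s _ => e (head 0 s))) => //.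
    move=> [|v [|v' s]] y [|] //= _ yn _.
    by rewrite [tword [::]]big_nil [tword _]big_seq1 mulr1 CE.
  by rewrite addn0.
have [X XP] : exists X : seq V, forall (F : lmodType k) (h : tensalg V -> F),
    linear h -> (forall s, size s = n.+1 -> {subset s <= X} -> h (tword s) = 0) ->
    h w = 0 by apply: tpow_letters; case/andP: wW.
have [ed edX] := dual_system X.
have : w - \sum_(a <- ed) tgen a.1 * C a.2 w = 0.
  apply: (XP _ (fun w => w - \sum_(a <- ed) tgen a.1 * C a.2 w)) => [c x y|].
    rewrite scalerBr addrACA -opprD; congr (_ + - _).
    rewrite scaler_sumr -big_split; apply: eq_bigr => a _ /=.
    by rewrite Cl mulrDr scalerAr.
  case=> [//|v s] [sn] sX; apply/eqP; rewrite subr_eq0; apply/eqP.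
  have -> : tword (v :: s) = tgen v * tword s by rewrite /tword big_cons.
  rewrite -{1}(edX v); last by apply: sX; rewrite mem_head.
  rewrite (lin_sum (@tgen_linear _ V)) mulr_suml; apply: eq_bigr => a _.
  rewrite CE; last by rewrite -sn tword_tpow.
  by rewrite (linZ (@tgen_linear _ V)) -scalerAl -scalerAr.
move/eqP; rewrite subr_eq0 => /eqP ->; apply: rpred_sum => a _.
by apply: mem_lspan; exists a.1, (C a.2 w).
Qed.

Lemma koszulW_right n w : w \in W n.+1 ->
  w \in lspan (fun y => exists v u, u \in W n /\ y = u * tgen v).
Proof.
move=> wW; pose g (e : {linear V -> k^o}) (x : seq V) : tensalg V :=
  (e (last 0 x) : k) *: tword (take n x).
have gE e s v : size s = n -> g e (rcons s v) = (e v : k) *: tword s.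
  by move=> sn; rewrite /g last_rcons -cats1 take_size_cat.
have gm e : multilinear n.+1 (g e).
  move=> s; elim/last_ind => [|t u _] c v v'.
    rewrite !cats1 addn0 => -[sn]; rewrite !gE //.
    by rewrite linearP scalerDl scalerA.
  rewrite size_rcons -!rcons_cons -!rcons_cat => -[stn].
  rewrite !gE ?size_cat /=; try lia.
  by rewrite tword_linear_at /= scalerDr !scalerA mulrC.
pose C e (y : tensalg V) := word_ext n.+1 (g e) y.
have Cl e : linear (C e) := word_ext_linear (gm e).
have rE s v : tword (rcons s v) = tword s * tgen v.
  by rewrite -cats1 twordM; congr (_ * _); rewrite /tword big_seq1.
have CE e v y : y \in tpow V n -> C e (y * tgen v) = (e v : k) *: y.
  move: y; apply: tpow_eq => [c x y|c x y|s sn].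
  - by rewrite mulrDl -scalerAl Cl.
  - by rewrite scalerDr !scalerA mulrC.
  by rewrite -rE /C word_ext_word // /weight_ext size_rcons sn eqxx gE.
have CW e : C e w \in W n.
  apply: (@contraction_koszulW (C e) 0 n 1 (fun _ s => e (head 0 s))) => //.
    move=> [|//] y [|v [|v' s]] //= _ yn _.
    by rewrite [tword [::]]big_nil [tword _]big_seq1 mul1r CE.
  by rewrite add0n addn1.
have [X XP] : exists X : seq V, forall (F : lmodType k) (h : tensalg V -> F),
    linear h -> (forall s, size s = n.+1 -> {subset s <= X} -> h (tword s) = 0) ->
    h w = 0 by apply: tpow_letters; case/andP: wW.
have [ed edX] := dual_system X.
have : w - \sum_(a <- ed) C a.2 w * tgen a.1 = 0.
  apply: (XP _ (fun w => w - \sum_(a <- ed) C a.2 w * tgen a.1)) => [c x y|].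
    rewrite scalerBr addrACA -opprD; congr (_ + - _).
    rewrite scaler_sumr -big_split; apply: eq_bigr => a _ /=.
    by rewrite Cl mulrDl scalerAl.
  elim/last_ind => [//|s v _]; rewrite size_rcons => -[sn] sX.
  apply/eqP; rewrite subr_eq0; apply/eqP.
  rewrite rE -{1}(edX v); last by apply: sX; rewrite mem_rcons mem_head.
  rewrite (lin_sum (@tgen_linear _ V)) mulr_sumr; apply: eq_bigr => a _.
  rewrite CE; last by rewrite -sn tword_tpow.
  by rewrite (linZ (@tgen_linear _ V)) -scalerAr -scalerAl.
move/eqP; rewrite subr_eq0 => /eqP ->; apply: rpred_sum => a _.
by apply: mem_lspan; exists a.1, (C a.2 w).
Qed.

(** $W_{a+r+b} \subseteq V^{\otimes a} \otimes W_r \otimes V^{\otimes b}$: this is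
    what makes a factor of an element of $W_n$ an element of $W_r$.  The outer
    letters are split off one at a time. *)
Lemma koszulW_split a r b w : w \in W (a + r + b) ->
  w \in lspan (fun y => exists s u t,
    [/\ size s = a, u \in W r, size t = b & y = tword s * u * tword t]).
Proof.
elim: b w => [|b IHb] w.
  rewrite addn0; elim: a w => [|a IHa] w wW.
    by apply: mem_lspan; exists [::], w, [::]; rewrite /tword !big_nil mul1r mulr1.
  elim/lspan_ind: (koszulW_left wW) => [|c _ y [v [u [/IHa uW ->]]] IH].
    exact: rpred0.
  apply: rpredD => //; apply: rpredZ; elim/lspan_ind: uW => [|d _ u'
    [s [x [t [sa xW tb ->]]]] IH'].
    by rewrite mulr0 rpred0.
  rewrite mulrDr -scalerAr; apply: rpredD => //; apply: rpredZ.
  apply: mem_lspan; exists (v :: s), x, t; split=> //=; first by rewrite sa.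
  by rewrite !mulrA; congr (_ * _ * _); rewrite /tword big_cons.
rewrite addnS => wW.
elim/lspan_ind: (koszulW_right wW) => [|c _ y [v [u [/IHb uW ->]]] IH].
  exact: rpred0.
apply: rpredD => //; apply: rpredZ; elim/lspan_ind: uW => [|d _ u'
    [s [x [t [sa xW tb ->]]]] IH'].
  by rewrite mul0r rpred0.
rewrite mulrDl -scalerAl; apply: rpredD => //; apply: rpredZ.
apply: mem_lspan; exists s, x, (rcons t v); split=> //=.
  by rewrite size_rcons tb.
by rewrite -cats1 twordM mulrA; congr (_ * _); rewrite /tword big_seq1.
Qed.

End Splitting.

(** * Removing the projections *)

Section Blocks.
Variables (k : fieldType) (V F : lmodType k).

(** This lemma and the next repeat the definition with the letters in the carrier of
    [V] itself: unfolding [multilinear] shows them in convertible carriers, and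
    linear arithmetic then fails to identify the sizes of words. *)
Lemma multilinearI n (g : seq V -> F) :
  (forall (s t : seq V) (c : k) (v w : V), (size s + size t).+1 = n ->
     g (s ++ (c *: v + w) :: t) = c *: g (s ++ v :: t) + g (s ++ w :: t)) ->
  multilinear n g.
Proof. by []. Qed.

Lemma multilinearE n (g : seq V -> F) : multilinear n g ->
  forall (s t : seq V) (c : k) (v w : V), (size s + size t).+1 = n ->
    g (s ++ (c *: v + w) :: t) = c *: g (s ++ v :: t) + g (s ++ w :: t).
Proof. by []. Qed.

Lemma slice_mid (s y t : seq V) u r : size s = u -> size y = r ->
  slice (s ++ y ++ t) u.+1 (u + r) = y.
Proof.
move=> <- <-; rewrite /slice subSS addKn drop_size_cat //.
by rewrite take_size_cat.
Qed.

Lemma linear_at_block (D : pred nat) (g : seq V -> F) s y y' t :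
  linear_at D g -> size y = size y' ->
  (forall i, (i < size y)%N -> ~~ D (size s + i)%N) ->
  g (s ++ y ++ t) = g (s ++ y' ++ t).
Proof.
move=> gD; elim: y y' s => [|v y IH] [|v' y'] s //= [yy] Dn.
rewrite (linear_at_const gD (y ++ t) v v'); last by rewrite -[size s]addn0 Dn.
rewrite -!cat_rcons; apply: IH => // i iy.
by rewrite size_rcons addSnnS Dn.
Qed.

(** Fixing the outer letters of a multilinear function leaves a multilinear function
    of the middle ones. *)
Lemma word_ext_mid n a r b (g : seq V -> F) s t y :
  multilinear n g -> (a + r + b)%N = n -> size s = a -> size t = b ->
  y \in tpow V r ->
  word_ext n g (tword s * y * tword t) = word_ext r (fun x => g (s ++ x ++ t)) y.
Proof.
move=> gm nE sa tb; move: y.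
have gm' : multilinear r (fun x => g (s ++ x ++ t)).
  move=> s' t' c v w e; rewrite -!catA !(catA s) !cat_cons gm //.
  by rewrite !size_cat sa tb -nE -e; lia.
apply: tpow_eq => [c x y||x xr].
- by rewrite mulrDr mulrDl -scalerAr -scalerAl word_ext_linear.
- exact: word_ext_linear.
rewrite -!twordM !word_ext_word // /weight_ext !size_cat sa xr tb nE !eqxx.
by rewrite -catA.
Qed.

Variables (n u r : nat) (D : pred nat) (K : seq V -> seq V -> F).
Hypotheses (urn : (u + r <= n)%N)
  (DE : forall i, (i < n)%N -> D i = ~~ (u <= i < u + r)%N)
  (K_mult : forall x, multilinear r (K x)) (K_lin : forall y, linear_at D (K^~ y)).

(** A letter of [x] is seen either by the first argument of [K] or by the slice,
    never by both. *)
Lemma multilinear_slice :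
  multilinear n (fun x => K x (slice x u.+1 (u + r))).
Proof.
apply: multilinearI => s t c v w e; have sn : (size s < n)%N by lia.
rewrite /slice subSS addKn /= !drop_cat.
case: (ltnP (size s) u) => su.
  have -> : (u < size s)%N = false by lia.
  have -> : (u - size s)%N = (u - size s).-1.+1 by lia.
  by rewrite /= K_lin DE //; have -> : (u <= size s < u + r)%N = false by lia.
have E x : (if (u < size s)%N then drop u s ++ x :: t
            else drop (u - size s) (x :: t)) = drop u s ++ x :: t.
  by case: ltngtP su => // -> _; rewrite subnn drop0 drop_size.
rewrite !E !take_cat size_drop; case: (ltnP r (size s - u)) => rs.
  by rewrite K_lin DE //; have -> : (u <= size s < u + r)%N = false by lia.
case/boolP: (u <= size s < u + r)%N => sr; last first.
  have -> : (r - (size s - u) = 0)%N by lia.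
  by rewrite !take0 K_lin DE // sr.
have -> : (r - (size s - u))%N = (r - (size s - u)).-1.+1 by lia.
rewrite /= (multilinearE (K_mult _)); last by rewrite size_drop size_takel; lia.
by congr (_ *: _ + _); apply: (linear_at_const (K_lin _)); rewrite DE ?sr.
Qed.

(** The zeros only fill the positions that the first argument of [K] ignores. *)
Lemma word_ext_slice s t y : size s = u -> (u + r + size t)%N = n -> y \in tpow V r ->
  word_ext n (fun x => K x (slice x u.+1 (u + r))) (tword s * y * tword t) =
  word_ext r (K (s ++ nseq r 0 ++ t)) y.
Proof.
move=> su tn yr; rewrite (word_ext_mid multilinear_slice tn su erefl yr).
apply: eq_word_ext => x xr; rewrite slice_mid //.
apply: (linear_at_block _ (K_lin x)) => [|i]; first by rewrite size_nseq.
by rewrite xr => ir; rewrite DE; lia.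
Qed.

End Blocks.

Section ProjectionRemoval.
Variables (k : fieldType) (V : lmodType k) (N : nat) (R : homog_rel V N).

(** Equality of the linear maps induced on $W_n$, where a factor of a tensor and its
    projection cannot be told apart. *)
Definition eqW (F : lmodType k) n (g h : seq V -> F) :=
  forall w : koszulW R n, word_ext n g (val w) = word_ext n h (val w).

(** An element of $W_n$ is a sum of products $s u t$ with $u \in W_r$ in the positions
    of the slice, by [koszulW_split].  For such a product the first argument of [K]
    depends on [s] and [t] only, and the projection fixes [u]. *)
Lemma eqW_proj (F : lmodType k) (D : pred nat) n u r (K : seq V -> seq V -> F) :
  (u + r <= n)%N -> (forall i, (i < n)%N -> D i = ~~ (u <= i < u + r)%N) ->
  (forall x, multilinear r (K x)) -> (forall y, linear_at D (K^~ y)) ->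
  eqW n (fun x => word_ext r (K x) (val (wfac R r x u.+1 (u + r))))
        (fun x => K x (slice x u.+1 (u + r))).
Proof.
move=> urn DE K_mult K_lin [w /= wW].
pose L x (y : tensalg V) := word_ext r (K x) (val (koszulW_proj R r y)).
have Ll x : linear (L x).
  by move=> c y z; rewrite /L koszulW_proj_linear linearP word_ext_linear.
have KL_mult x : multilinear r (fun y => L x (tword y)).
  by move=> s t c v v' _; rewrite tword_linear_at /= Ll.
have KL_lin y : linear_at D (fun x => L x (tword y)).
  move=> s t c v v'; rewrite /L; case: ifP => Ds.
    rewrite -word_ext_comb; apply: eq_word_ext => z _.
    by rewrite K_lin Ds.
  by apply: eq_word_ext => z _; rewrite K_lin Ds.
have m1 := multilinear_slice urn DE KL_mult KL_lin.
have m2 := multilinear_slice urn DE K_mult K_lin.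
have nE : (u + r + (n - (u + r)))%N = n by lia.
rewrite -nE in wW; elim/lspan_ind: (koszulW_split wW) => [|c _ y
  [s [x [t [su xW tb ->]]]] IH].
  by rewrite (lin0 (word_ext_linear m1)) (lin0 (word_ext_linear m2)).
rewrite (word_ext_linear m1) (word_ext_linear m2) IH; congr (_ *: _ + _).
have /andP[xr _] := xW; rewrite -tb in nE.
rewrite [LHS](word_ext_slice urn DE KL_mult KL_lin su nE xr).
rewrite [RHS](word_ext_slice urn DE K_mult K_lin su nE xr).
set x0 := s ++ _; transitivity (L x0 x).
  move: x xr {xW}; apply: tpow_eq => [||z zr]; [exact: word_ext_linear| by [] |].
  by rewrite word_ext_word // /weight_ext zr eqxx.
by rewrite /L (koszulW_projK (KoszulW xW)).
Qed.

Lemma eqW_word (F : lmodType k) n (g h : seq V -> F) :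
  (forall x, size x = n -> g x = h x) -> eqW n g h.
Proof. by move=> gh w; exact: eq_word_ext. Qed.

Lemma eqW_trans (F : lmodType k) n (g h l : seq V -> F) :
  eqW n g h -> eqW n h l -> eqW n g l.
Proof. by move=> gh hl w; rewrite gh. Qed.

Lemma eqWD (F : lmodType k) n (g g' h h' : seq V -> F) : eqW n g g' -> eqW n h h' ->
  eqW n (fun x => g x + h x) (fun x => g' x + h' x).
Proof. by move=> gg hh w; rewrite !word_extD gg hh. Qed.

Lemma eqWZ (F : lmodType k) n c (g g' : seq V -> F) : eqW n g g' ->
  eqW n (fun x => c *: g x) (fun x => c *: g' x).
Proof. by move=> gg w; rewrite !word_extZ gg. Qed.

Lemma eqWN (F : lmodType k) n (g g' : seq V -> F) : eqW n g g' ->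
  eqW n (fun x => - g x) (fun x => - g' x).
Proof.
move=> /(eqWZ (-1)) gg w; rewrite -[LHS](eq_word_ext (g := fun x => -1 *: g x)).
  by rewrite gg; apply: eq_word_ext => x _; rewrite scaleN1r.
by move=> x _; rewrite scaleN1r.
Qed.

Lemma eqW_sum (F : lmodType k) n I (s : seq I) (Q : pred I) (g h : I -> seq V -> F) :
  (forall i, Q i -> eqW n (g i) (h i)) ->
  eqW n (fun x => \sum_(i <- s | Q i) g i x) (fun x => \sum_(i <- s | Q i) h i x).
Proof.
by move=> gh w; rewrite !word_ext_sum; apply: eq_bigr => i Qi; exact: gh.
Qed.

End ProjectionRemoval.

(** * Telescoping over a triangle *)

Section Triangle.
Variables (E : zmodType) (N : nat) (S : nat -> nat -> E).
Hypothesis N2 : (2 <= N)%N.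

Lemma telescope_tri_right :
  \sum_(i < N) \sum_(j < N | (i + j <= N - 2)%N) (S i j.+1 - S i j) =
  \sum_(i < N) (S i (N.-1 - i)%N - S i 0%N).
Proof.
apply: eq_bigr => i _; have iN := ltn_ord i.
rewrite -(telescope_sumr (S i)) // big_mkord.
rewrite (big_ord_widen_cond N predT (fun j => S i j.+1 - S i j)); last by lia.
by apply: eq_bigl => j /=; lia.
Qed.

End Triangle.

Lemma exchange_tri (E : zmodType) N (S : nat -> nat -> E) :
  \sum_(i < N) \sum_(j < N | (i + j <= N - 2)%N) S i j =
  \sum_(i < N) \sum_(j < N | (i + j <= N - 2)%N) S j i.
Proof.
rewrite (exchange_big_dep predT) //=; apply: eq_bigr => i _.
by apply: eq_bigl => j; rewrite addnC.
Qed.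

Lemma telescope_tri_left (E : zmodType) N (S : nat -> nat -> E) : (2 <= N)%N ->
  \sum_(i < N) \sum_(j < N | (i + j <= N - 2)%N) (S i.+1 j - S i j) =
  \sum_(j < N) (S (N.-1 - j)%N j - S 0%N j).
Proof.
move=> N2; rewrite -(@telescope_tri_right _ _ (fun i j => S j i)) //.
exact: (exchange_tri N (fun i j => S i.+1 j - S i j)).
Qed.

Lemma reverse_sum (E : zmodType) N (S : nat -> E) :
  \sum_(i < N) S (N.-1 - i)%N = \sum_(i < N) S i.
Proof.
rewrite [RHS](reindex_inj rev_ord_inj); apply: eq_bigr => i _ /=.
by congr S; lia.
Qed.

Lemma antidiagonal_sum (E : zmodType) N (S : nat -> nat -> E) :
  \sum_(i < N) S i (N.-1 - i)%N = \sum_(i < N) S (N.-1 - i)%N i.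
Proof.
rewrite -(reverse_sum N (fun i => S i (N.-1 - i)%N)); apply: eq_bigr => i _.
by congr (S _ _); have := ltn_ord i; lia.
Qed.

(** A step along the antidiagonal is a step to the left minus a step to the right; the
    two sums over the hypotenuse $i + j = N - 1$ cancel. *)
Lemma telescope_tri_diag (E : zmodType) N (S : nat -> nat -> E) : (2 <= N)%N ->
  \sum_(i < N) \sum_(j < N | (i + j <= N - 2)%N) (S i.+1 j - S i j.+1) =
  \sum_(i < N) S i 0%N - \sum_(j < N) S 0%N j.
Proof.
move=> N2.
transitivity (\sum_(i < N) \sum_(j < N | (i + j <= N - 2)%N) (S i.+1 j - S i j) -
  \sum_(i < N) \sum_(j < N | (i + j <= N - 2)%N) (S i j.+1 - S i j)).
  rewrite -sumrB; apply: eq_bigr => i _; rewrite -sumrB; apply: eq_bigr => j _.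
  by rewrite opprB addrA subrK.
rewrite telescope_tri_left // telescope_tri_right // !sumrB antidiagonal_sum.
by rewrite opprB addrC addrA subrK.
Qed.

(** * The operators on bare words *)

(* Descends through equal heads until the positions in the words are compared. *)
Ltac index_congr := lazymatch goal with
  | |- @eq nat _ _ => lia
  | |- _ => progress f_equal; index_congr
  end.

Lemma nu_double N n : nu N n.*2 = (N * n)%N.
Proof. by rewrite /nu doubleK odd_double addn0. Qed.

Lemma nu_doubleS N n : nu N n.*2.+1 = (N * n).+1.
Proof. by rewrite /nu /= uphalf_double odd_double addn1. Qed.

(** The four definitions repeat the formulas for the differentials and the cap
    products, with an arbitrary function [phi] of words for the cochain and an
    arbitrary [h m y] for the chain $m \otimes y$.  Taking for [h] another operator of
    this kind composes the formulas without any projection in between. *)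
Section FormalOperators.
Variables (k : fieldType) (V : lmodType k) (N : nat) (R : homog_rel V N).
Local Notation afac := (afac R).
Local Notation nu := (nu N).

Definition dcochain (P : bimodule (homalg R)) p (phi : seq V -> P) (x : seq V) : P :=
  let p' := p./2 in
  if odd p then
    \sum_(i < N) (afac x 1 i *> phi (slice x (i + 1) (i + N * p' + 1))
                    <* afac x (i + N * p' + 2) (N * p' + N))
  else
    phi (slice x 1 (N * p')) <* afac x (N * p' + 1) (N * p' + 1)
    - afac x 1 1 *> phi (slice x 2 (N * p' + 1)).

Definition dchain (M : bimodule (homalg R)) (F : lmodType k) q
    (h : M -> seq V -> F) (m : M) (x : seq V) : F :=
  let q' := q./2 in
  if odd q then
    h (m <* afac x 1 1) (slice x 2 (N * q' + 1))
    - h (afac x (N * q' + 1) (N * q' + 1) *> m) (slice x 1 (N * q'))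
  else
    \sum_(i < N)
      h (afac x (i + N * q' - N + 2) (N * q') *> m <* afac x 1 i)
        (slice x (i + 1) (i + N * q' - N + 1)).

Definition lcap (M P : bimodule (homalg R)) (F : lmodType k) p q
    (phi : seq V -> P) (h : tensA P M -> seq V -> F) (m : M) (x : seq V) : F :=
  let p' := p./2 in let q' := q./2 in
  if odd p && ~~ odd q then
    - \sum_(i < N) \sum_(j < N | (i + j <= N - 2)%N)
        h (tpureA
             (afac x (N * q' - N * p' - N + i + 2) (N * q' - N * p' - j - 1)
                *> phi (slice x (N * q' - N * p' - j) (N * q' - j)))
             (afac x (N * q' - j + 1) (N * q') *> m <* afac x 1 i))
          (slice x (i + 1) (i + N * q' - N * p' - N + 1))
  else
    h (tpureA (phi (slice x (nu (q - p) + 1) (nu q))) m) (slice x 1 (nu (q - p))).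

Definition rcap (M P : bimodule (homalg R)) (F : lmodType k) p q
    (phi : seq V -> P) (h : tensA M P -> seq V -> F) (m : M) (x : seq V) : F :=
  let p' := p./2 in let q' := q./2 in
  if odd p && ~~ odd q then
    \sum_(i < N) \sum_(j < N | (i + j <= N - 2)%N)
      h (tpureA
           (afac x (N * q' - j + 1) (N * q') *> m <* afac x 1 i)
           (phi (slice x (i + 1) (N * p' + i + 1))
              <* afac x (N * p' + i + 2) (N * p' + N - j - 1)))
        (slice x (N * p' + N - j) (N * q' - j))
  else
    (-1) ^+ (p * q) *:
      h (tpureA m (phi (slice x 1 (nu p)))) (slice x (nu p + 1) (nu q)).

Lemma slice_slice (x : seq V) u v i j : (u + j <= v)%N ->
  slice (slice x u.+1 v) i.+1 j = slice x (u + i).+1 (u + j).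
Proof.
move=> ujv; rewrite /slice !subSS /= subnDl; case: (leqP i j) => ij; last first.
  by rewrite (eqP (ltnW ij)) !take0.
by rewrite addnC -drop_drop !take_drop subnK // take_takel //; lia.
Qed.

Lemma afac_slice (x : seq V) u v i j : (u + j <= v)%N ->
  afac (slice x u.+1 v) i.+1 j = afac x (u + i).+1 (u + j).
Proof. by move=> ujv; rewrite /afac slice_slice. Qed.

Lemma afac_nil (x : seq V) i j : (j < i)%N -> afac x i j = 1.
Proof.
move=> ji; rewrite /afac /slice; have -> : (j.+1 - i = 0)%N by lia.
by rewrite take0 /tword big_nil rmorph1.
Qed.

Lemma afac_cat (x : seq V) u v w : (u <= v <= w)%N ->
  afac x u.+1 v * afac x v.+1 w = afac x u.+1 w.
Proof.
move=> /andP[uv vw]; rewrite /afac -rmorphM -twordM; congr (quoalg_pi _ (tword _)).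
rewrite /slice !subSS /=; have -> : (w - u = (v - u) + (w - v))%N by lia.
by rewrite takeD drop_drop subnK.
Qed.

Section Actions.
Variables (M : bimodule (homalg R)) (x : seq V) (m : M).

Lemma lact_cat u v v' w : v' = v.+1 -> (u <= v <= w)%N ->
  afac x u.+1 v *> (afac x v' w *> m) = afac x u.+1 w *> m.
Proof. by move=> -> uvw; rewrite -lactM afac_cat. Qed.

Lemma ract_cat u v v' w : v' = v.+1 -> (u <= v <= w)%N ->
  m <* afac x u.+1 v <* afac x v' w = m <* afac x u.+1 w.
Proof. by move=> -> uvw; rewrite -ractM afac_cat. Qed.

Lemma lact_nil i j : (j < i)%N -> afac x i j *> m = m.
Proof. by move=> ji; rewrite afac_nil // lact1. Qed.

Lemma ract_nil i j : (j < i)%N -> m <* afac x i j = m.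
Proof. by move=> ji; rewrite afac_nil // ract1. Qed.

End Actions.

(** With $a = N p'$ and $N q' = a + b + N$ all positions are sums, up to the distance of
    [j] from [N], and the bounds of a factor have the form [u.+1, v] for which
    [slice_slice] and the lemmas on adjacent factors are stated. *)
Section CleanForms.
Variables (M P : bimodule (homalg R)) (F : lmodType k) (x : seq V) (m : M).
Variables (phi : seq V -> P).

Lemma dcochain_even p a : ~~ odd p -> (N * p./2)%N = a ->
  dcochain p phi x = phi (slice x 1 a) <* afac x a.+1 a.+1
                     - afac x 1 1 *> phi (slice x 2 a.+1).
Proof. by move=> op pa; rewrite /dcochain (negbTE op) pa addn1. Qed.

Lemma dcochain_odd p a : odd p -> (N * p./2)%N = a ->
  dcochain p phi x = \sum_(i < N) (afac x 1 i *>
    (phi (slice x i.+1 (a + i).+1) <* afac x (a + i).+2 (a + N))).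
Proof.
move=> op pa; rewrite /dcochain op pa; apply: eq_bigr => i _.
by rewrite lractA !addn1 addn2 (addnC i).
Qed.

Lemma dchain_odd q c (h : M -> seq V -> F) : odd q -> (N * q./2)%N = c ->
  dchain q h m x = h (m <* afac x 1 1) (slice x 2 c.+1)
                   - h (afac x c.+1 c.+1 *> m) (slice x 1 c).
Proof. by move=> oq qc; rewrite /dchain oq qc addn1. Qed.

Lemma dchain_even q c (h : M -> seq V -> F) : ~~ odd q -> (N * q./2)%N = (c + N)%N ->
  dchain q h m x = \sum_(i < N)
    h (afac x (c + i).+2 (c + N) *> (m <* afac x 1 i)) (slice x i.+1 (c + i).+1).
Proof.
move=> oq qc; rewrite /dchain (negbTE oq) qc; apply: eq_bigr => i _.
by rewrite lractA; index_congr.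
Qed.

Lemma lcap_odd_even p q a b (h : tensA P M -> seq V -> F) : odd p -> ~~ odd q ->
  (N * p./2)%N = a -> (N * q./2)%N = (a + b + N)%N ->
  lcap p q phi h m x = - \sum_(i < N) \sum_(j < N | (i + j <= N - 2)%N)
    h (tpureA (afac x (b + i).+2 (b + (N.-1 - j)) *>
                 phi (slice x (b + (N.-1 - j)).+1 (a + b + (N - j))))
              (afac x (a + b + (N - j)).+1 (a + b + N) *> (m <* afac x 1 i)))
      (slice x i.+1 (b + i).+1).
Proof.
move=> op oq pa qb; rewrite /lcap op oq pa qb /=; congr (- _).
apply: eq_bigr => i _; apply: eq_bigr => j ij; rewrite lractA.
have := ltn_ord i; have := ltn_ord j => jN iN.
index_congr.
Qed.

Lemma lcap_other p q d n (h : tensA P M -> seq V -> F) : ~~ (odd p && ~~ odd q) ->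
  nu (q - p) = d -> nu q = n ->
  lcap p q phi h m x = h (tpureA (phi (slice x d.+1 n)) m) (slice x 1 d).
Proof. by move=> opq dE nE; rewrite /lcap (negbTE opq) dE nE addn1. Qed.

Lemma rcap_odd_even p q a b (h : tensA M P -> seq V -> F) : odd p -> ~~ odd q ->
  (N * p./2)%N = a -> (N * q./2)%N = (a + b + N)%N ->
  rcap p q phi h m x = \sum_(i < N) \sum_(j < N | (i + j <= N - 2)%N)
    h (tpureA (afac x (a + b + (N - j)).+1 (a + b + N) *> (m <* afac x 1 i))
         (phi (slice x i.+1 (a + i).+1) <* afac x (a + i).+2 (a + (N.-1 - j))))
      (slice x (a + (N.-1 - j)).+1 (a + b + (N - j))).
Proof.
move=> op oq pa qb; rewrite /rcap op oq pa qb /=.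
apply: eq_bigr => i _; apply: eq_bigr => j ij; rewrite lractA.
have := ltn_ord i; have := ltn_ord j => jN iN.
index_congr.
Qed.

Lemma rcap_other p q a n (h : tensA M P -> seq V -> F) : ~~ (odd p && ~~ odd q) ->
  nu p = a -> nu q = n ->
  rcap p q phi h m x =
  (-1) ^+ (p * q) *: h (tpureA m (phi (slice x 1 a))) (slice x a.+1 n).
Proof. by move=> opq aE nE; rewrite /rcap (negbTE opq) aE nE addn1. Qed.

End CleanForms.
End FormalOperators.

(** * The Leibniz formulas on bare words *)

Section LeftIdentity.
Variables (k : fieldType) (V : lmodType k) (N : nat) (R : homog_rel V N).
Variables (M P : bimodule (homalg R)) (F : lmodType k) (p q : nat).
Variables (phi : seq V -> P) (h : tensA P M -> seq V -> F) (m : M) (x : seq V).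
Hypotheses (h_lin : forall y, linear (h^~ y)) (pq : (p < q)%N).
Local Notation afac := (afac R).
Local Notation nu := (nu N).

Let N2 : (2 <= N)%N := rel_degree R.

(** [T i j], for $i + j \le N - 1$, is the term where [i] letters have moved from the
    front to the right of [m] and [j] letters from the back to its left.  The
    differential of the cochain takes a letter off either end of the argument of
    [phi], so the cap product with it is a sum of differences in [j].  What remains
    are the sides $j = 0$ and $i + j = N - 1$ of the triangle. *)
Lemma lcap_dchain_even_even : ~~ odd p -> ~~ odd q ->
  lcap p q phi (dchain (q - p) h) m x =
  lcap p.+1 q (dcochain p phi) h m x + dchain q (lcap p q.-1 phi h) m x.
Proof.
move=> op oq; have [r qE] : exists r, q./2 = (p./2 + r.+1)%N.
  by exists (q./2 - p./2).-1; lia.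
have [a aE] : exists a, (N * p./2)%N = a by exists (N * p./2)%N.
have [b bE] : exists b, (N * r)%N = b by exists (N * r)%N.
have qab : (N * q./2 = a + b + N)%N by rewrite qE mulnDr mulnS aE bE; lia.
pose T i j := h (tpureA (afac x (b + i).+2 (b + (N - j)) *>
                 phi (slice x (b + (N - j)).+1 (a + b + (N - j))))
              (afac x (a + b + (N - j)).+1 (a + b + N) *> (m <* afac x 1 i)))
      (slice x i.+1 (b + i).+1).
have L0 : lcap p q phi (dchain (q - p) h) m x = \sum_(i < N) T i 0%N.
  have dE : (q - p = r.+1.*2)%N by lia.
  rewrite (lcap_other _ _ _ (d := b + N) (n := a + b + N)); first last.
  - have -> : q = q./2.*2 by lia.
    by rewrite nu_double.
  - by rewrite dE nu_double mulnS bE addnC.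
  - by rewrite (negbTE op).
  rewrite (dchain_even _ _ (c := b)); first last.
  - by rewrite dE doubleK mulnS bE addnC.
  - by rewrite dE odd_double.
  apply: eq_bigr => i _; have iN := ltn_ord i.
  rewrite !(slice_slice, afac_slice); [| lia..].
  rewrite ract_tpureA lact_tpureA /T subn0 !add0n.
  by rewrite [X in _ = h (tpureA _ X) _]lact_nil.
have L1 : lcap p.+1 q (dcochain p phi) h m x =
    - \sum_(i < N) \sum_(j < N | (i + j <= N - 2)%N) (T i j.+1 - T i j).
  rewrite (lcap_odd_even _ _ _ (a := a) (b := b)) //; last first.
    by rewrite -aE; congr (_ * _)%N; lia.
  congr (- _); apply: eq_bigr => i _; apply: eq_bigr => j ij; rewrite /T.
  have [e NE] : exists e, (N = e + j.+1)%N by exists (N - j.+1)%N; lia.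
  have -> : (N.-1 - j = e)%N by lia.
  have -> : (N - j = e.+1)%N by lia.
  have -> : (N - j.+1 = e)%N by lia.
  rewrite (dcochain_even _ _ op aE) !(slice_slice, afac_slice); [|lia..].
  rewrite (linB ((lact_bilin P).2 _)) (linB ((tpureA_bilin P M).1 _)).
  rewrite (linB (h_lin _)) -lractA tpureA_balanced !lact_cat; [|lia..].
  index_congr.
have L2 : dchain q (lcap p q.-1 phi h) m x = \sum_(i < N) T i (N.-1 - i)%N.
  rewrite (dchain_even _ _ (c := a + b)) //.
  apply: eq_bigr => i _; have iN := ltn_ord i.
  rewrite (lcap_other _ _ _ (d := b.+1) (n := (a + b).+1)); first last.
  - have -> : q.-1 = ((p./2 + r).*2.+1)%N by lia.
    by rewrite nu_doubleS mulnDr aE bE.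
  - have -> : (q.-1 - p = r.*2.+1)%N by lia.
    by rewrite nu_doubleS bE.
  - by rewrite (negbTE op).
  rewrite !slice_slice; [| lia..].
  rewrite /T [X in _ = h (tpureA X _) _]lact_nil; last by lia.
  index_congr.
by rewrite L0 L1 L2 telescope_tri_right // sumrB opprB subrK.
Qed.

(** Here it is the differential of the chain that takes a letter off either end of the
    word: the term moves to $(i + 1, j)$ or $(i, j + 1)$.  The sides $j = 0$ and
    $i = 0$ remain. *)
Lemma lcap_dchain_odd_odd : odd p -> odd q ->
  lcap p q phi (dchain (q - p) h) m x =
  lcap p.+1 q (dcochain p phi) h m x - dchain q (lcap p q.-1 phi h) m x.
Proof.
move=> op oq; have [r qE] : exists r, q./2 = (p./2 + r.+1)%N.
  by exists (q./2 - p./2).-1; lia.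
have [a aE] : exists a, (N * p./2)%N = a by exists (N * p./2)%N.
have [b bE] : exists b, (N * r)%N = b by exists (N * r)%N.
have qab : (N * q./2 = a + b + N)%N by rewrite qE mulnDr mulnS aE bE; lia.
pose T i j := h (tpureA (afac x (b + i).+2 (b + (N - j)) *>
                 phi (slice x (b + (N - j)).+1 (a + b + (N - j)).+1))
              (afac x (a + b + (N - j)).+2 (a + b + N).+1 *> (m <* afac x 1 i)))
      (slice x i.+1 (b + i).+1).
have L0 : lcap p q phi (dchain (q - p) h) m x = \sum_(i < N) T i 0%N.
  have dE : (q - p = r.+1.*2)%N by lia.
  rewrite (lcap_other _ _ _ (d := b + N) (n := (a + b + N).+1)); first last.
  - have -> : q = q./2.*2.+1 by lia.
    by rewrite nu_doubleS qab.
  - by rewrite dE nu_double mulnS bE addnC.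
  - by rewrite oq andbF.
  rewrite (dchain_even _ _ (c := b)); first last.
  - by rewrite dE doubleK mulnS bE addnC.
  - by rewrite dE odd_double.
  apply: eq_bigr => i _; have iN := ltn_ord i.
  rewrite !(slice_slice, afac_slice); [| lia..].
  rewrite ract_tpureA lact_tpureA /T subn0 !add0n.
  by rewrite [X in _ = h (tpureA _ X) _]lact_nil.
have L1 : lcap p.+1 q (dcochain p phi) h m x = \sum_(j < N) T 0%N j.
  rewrite -(reverse_sum N (T 0%N)).
  rewrite (lcap_other _ _ _ (d := b.+1) (n := (a + b + N).+1)); first last.
  - have -> : q = q./2.*2.+1 by lia.
    by rewrite nu_doubleS qab.
  - have -> : (q - p.+1 = r.*2.+1)%N by lia.
    by rewrite nu_doubleS bE.
  - by rewrite oq andbF.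
  rewrite (dcochain_odd _ _ op aE) (lin_sum ((tpureA_bilin P M).1 _)).
  rewrite (lin_sum (h_lin _)); apply: eq_bigr => i _; have iN := ltn_ord i.
  rewrite !(slice_slice, afac_slice); [| lia..].
  rewrite -lractA tpureA_balanced /T ract_nil //.
  index_congr.
have L2 : dchain q (lcap p q.-1 phi h) m x =
    - \sum_(i < N) \sum_(j < N | (i + j <= N - 2)%N) (T i.+1 j - T i j.+1).
  rewrite (dchain_odd _ _ _ oq qab).
  have oq1 : ~~ odd q.-1 by lia.
  have qab1 : (N * q.-1./2 = a + b + N)%N.
    have -> : q.-1 = q./2.*2 by lia.
    by rewrite doubleK.
  rewrite !(lcap_odd_even _ _ _ _ op oq1 aE qab1).
  rewrite opprK addrC -opprB -sumrB; congr (- _); apply: eq_bigr => i _.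
  rewrite -sumrB; apply: eq_bigr => j ij; rewrite /T.
  have [e NE] : exists e, (N = e + j.+1)%N by exists (N - j.+1)%N; lia.
  have -> : (N.-1 - j = e)%N by lia.
  have -> : (N - j = e.+1)%N by lia.
  have -> : (N - j.+1 = e)%N by lia.
  rewrite !(slice_slice, afac_slice); [|lia..].
  rewrite ract_cat //; rewrite lractA lact_cat; [|lia..].
  index_congr.
by rewrite L0 L1 L2 telescope_tri_diag // opprK addrC subrK.
Qed.

(** No sum occurs: the two terms of each differential match one by one, the letter
    between [phi] and [m] being moved across the tensor product over the algebra. *)
Lemma lcap_dchain_even_odd : ~~ odd p -> odd q ->
  lcap p q phi (dchain (q - p) h) m x =
  lcap p.+1 q (dcochain p phi) h m x + dchain q (lcap p q.-1 phi h) m x.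
Proof.
move=> op oq; have [r qE] : exists r, q./2 = (p./2 + r)%N.
  by exists (q./2 - p./2)%N; lia.
have [a aE] : exists a, (N * p./2)%N = a by exists (N * p./2)%N.
have [b bE] : exists b, (N * r)%N = b by exists (N * r)%N.
have qab : (N * q./2 = a + b)%N by rewrite qE mulnDr aE bE.
have nE : nu q = (a + b).+1.
  have -> : q = q./2.*2.+1 by lia.
  by rewrite nu_doubleS qab.
have dE : (q - p = r.*2.+1)%N by lia.
rewrite (lcap_other _ _ _ (d := b.+1) _ _ _ nE); first last.
- by rewrite dE nu_doubleS bE.
- by rewrite oq andbF.
rewrite (dchain_odd _ _ _ (c := b)); first last.
- by rewrite dE /= uphalf_double bE.
- by rewrite dE /= odd_double.
rewrite (lcap_other _ _ _ (d := b) _ _ _ nE); first last.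
- have -> : (q - p.+1 = r.*2)%N by lia.
  by rewrite nu_double bE.
- by rewrite oq andbF.
rewrite (dcochain_even _ _ op aE) (dchain_odd _ _ _ oq qab).
have nE' : nu q.-1 = (a + b)%N.
  have -> : q.-1 = q./2.*2 by lia.
  by rewrite nu_double qab.
have dE' : nu (q.-1 - p) = b.
  have -> : (q.-1 - p = r.*2)%N by lia.
  by rewrite nu_double.
have opq1 : ~~ (odd p && ~~ odd q.-1) by rewrite (negbTE op).
rewrite !(lcap_other _ _ _ _ opq1 dE' nE').
rewrite !(slice_slice, afac_slice); [|lia..].
rewrite (linB ((tpureA_bilin P M).1 _)) (linB (h_lin _)) tpureA_balanced.
rewrite ract_tpureA lact_tpureA !add0n !addn0 !addSn !add0n !addn1 !addnS (addnC b a).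
by rewrite [RHS]addrC addrA subrK.
Qed.

(** The outer differential multiplies the coefficient by a letter on the right or on the
    left, which gives differences in [i].  The sides $i = 0$ and $i + j = N - 1$
    remain. *)
Lemma lcap_dchain_odd_even : odd p -> ~~ odd q ->
  lcap p q phi (dchain (q - p) h) m x =
  lcap p.+1 q (dcochain p phi) h m x - dchain q (lcap p q.-1 phi h) m x.
Proof.
move=> op oq; have [r qE] : exists r, q./2 = (p./2 + r.+1)%N.
  by exists (q./2 - p./2).-1; lia.
have [a aE] : exists a, (N * p./2)%N = a by exists (N * p./2)%N.
have [b bE] : exists b, (N * r)%N = b by exists (N * r)%N.
have qab : (N * q./2 = a + b + N)%N by rewrite qE mulnDr mulnS aE bE; lia.
pose T i j := h (tpureA (afac x (b + i).+1 (b + (N.-1 - j)) *>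
                 phi (slice x (b + (N.-1 - j)).+1 (a + b + (N - j))))
              (afac x (a + b + (N - j)).+1 (a + b + N) *> (m <* afac x 1 i)))
      (slice x i.+1 (b + i)).
have L0 : lcap p q phi (dchain (q - p) h) m x =
    - \sum_(i < N) \sum_(j < N | (i + j <= N - 2)%N) (T i.+1 j - T i j).
  rewrite (lcap_odd_even _ _ _ (a := a) (b := b)) //.
  congr (- _); apply: eq_bigr => i _; apply: eq_bigr => j ij; rewrite /T.
  have [e NE] : exists e, (N = e + j.+1)%N by exists (N - j.+1)%N; lia.
  have -> : (N.-1 - j = e)%N by lia.
  have -> : (N - j = e.+1)%N by lia.
  have dE : (q - p = r.*2.+1)%N by lia.
  rewrite (dchain_odd _ _ _ (c := b)); first last.
  - by rewrite dE /= uphalf_double bE.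
  - by rewrite dE /= odd_double.
  rewrite !(slice_slice, afac_slice); [|lia..].
  rewrite ract_tpureA lact_tpureA lractA ract_cat; [|lia..].
  rewrite [X in _ - h (tpureA X _) _]lact_cat; [|lia..].
  index_congr.
have L1 : lcap p.+1 q (dcochain p phi) h m x = \sum_(j < N) T 0%N j.
  rewrite -(reverse_sum N (T 0%N)).
  rewrite (lcap_other _ _ _ (d := b) (n := a + b + N)); first last.
  - have -> : q = q./2.*2 by lia.
    by rewrite nu_double qab.
  - have -> : (q - p.+1 = r.*2)%N by lia.
    by rewrite nu_double bE.
  - by rewrite /= op.
  rewrite (dcochain_odd _ _ op aE) (lin_sum ((tpureA_bilin P M).1 _)).
  rewrite (lin_sum (h_lin _)); apply: eq_bigr => i _; have iN := ltn_ord i.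
  rewrite !(slice_slice, afac_slice); [| lia..].
  rewrite -lractA tpureA_balanced /T ract_nil //.
  index_congr.
have L2 : dchain q (lcap p q.-1 phi h) m x = \sum_(j < N) T (N.-1 - j)%N j.
  rewrite -(antidiagonal_sum N T) (dchain_even _ _ (c := a + b)) //.
  apply: eq_bigr => i _; have iN := ltn_ord i.
  rewrite (lcap_other _ _ _ (d := b) (n := (a + b).+1)); first last.
  - have -> : q.-1 = ((p./2 + r).*2.+1)%N by lia.
    by rewrite nu_doubleS mulnDr aE bE.
  - have -> : (q.-1 - p = r.*2)%N by lia.
    by rewrite nu_double bE.
  - by rewrite op; lia.
  rewrite !slice_slice; [| lia..].
  rewrite /T [X in _ = h (tpureA X _) _]lact_nil; last by lia.
  index_congr.
by rewrite L0 L1 L2 telescope_tri_left // sumrB opprB.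
Qed.

End LeftIdentity.

Section RightIdentity.
Variables (k : fieldType) (V : lmodType k) (N : nat) (R : homog_rel V N).
Variables (M P : bimodule (homalg R)) (F : lmodType k) (p q : nat).
Variables (phi : seq V -> P) (h : tensA M P -> seq V -> F) (m : M) (x : seq V).
Hypotheses (h_lin : forall y, linear (h^~ y)) (pq : (p < q)%N).
Local Notation afac := (afac R).
Local Notation nu := (nu N).

Let N2 : (2 <= N)%N := rel_degree R.

(** The letters around [m] are those of the left case, and [phi] now follows them at
    the front of the word; the differential of the cochain gives differences in
    [i]. *)
Lemma rcap_dchain_even_even : ~~ odd p -> ~~ odd q ->
  rcap p q phi (dchain (q - p) h) m x =
  dchain q (rcap p q.-1 phi h) m x + rcap p.+1 q (dcochain p phi) h m x.
Proof.
move=> op oq; have [r qE] : exists r, q./2 = (p./2 + r.+1)%N.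
  by exists (q./2 - p./2).-1; lia.
have [a aE] : exists a, (N * p./2)%N = a by exists (N * p./2)%N.
have [b bE] : exists b, (N * r)%N = b by exists (N * r)%N.
have qab : (N * q./2 = a + b + N)%N by rewrite qE mulnDr mulnS aE bE; lia.
have nup : nu p = a.
  have -> : p = p./2.*2 by lia.
  by rewrite nu_double.
pose T i j := h
  (tpureA (afac x (a + b + (N - j)).+1 (a + b + N) *> (m <* afac x 1 i))
          (phi (slice x i.+1 (a + i)) <* afac x (a + i).+1 (a + (N.-1 - j))))
  (slice x (a + (N.-1 - j)).+1 (a + b + (N - j))).
have L0 : rcap p q phi (dchain (q - p) h) m x = \sum_(j < N) T 0%N j.
  have nuq : nu q = (a + b + N)%N.
    have -> : q = q./2.*2 by lia.
    by rewrite nu_double.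
  rewrite -(reverse_sum N (T 0%N)) (rcap_other _ _ _ _ _ nup nuq); last first.
    by rewrite (negbTE op).
  rewrite -signr_odd oddM (negbTE op) scale1r.
  have dE : (q - p = r.+1.*2)%N by lia.
  rewrite (dchain_even _ _ (c := b)); first last.
  - by rewrite dE doubleK mulnS bE addnC.
  - by rewrite dE odd_double.
  apply: eq_bigr => i _; have iN := ltn_ord i.
  rewrite !(slice_slice, afac_slice); [| lia..].
  rewrite ract_tpureA lact_tpureA /T [m <* _]ract_nil //.
  index_congr.
have L1 : dchain q (rcap p q.-1 phi h) m x = \sum_(j < N) T (N.-1 - j)%N j.
  rewrite -(antidiagonal_sum N T) (dchain_even _ _ (c := a + b)) //.
  apply: eq_bigr => i _; have iN := ltn_ord i.
  rewrite (rcap_other _ _ _ (n := (a + b).+1) _ _ nup); first last.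
  - have -> : q.-1 = ((p./2 + r).*2.+1)%N by lia.
    by rewrite nu_doubleS mulnDr aE bE.
  - by rewrite (negbTE op).
  rewrite -signr_odd oddM (negbTE op) scale1r.
  rewrite !slice_slice; [| lia..].
  rewrite /T [X in _ = h (tpureA _ X) _]ract_nil; last by lia.
  index_congr.
have L2 : rcap p.+1 q (dcochain p phi) h m x =
    - \sum_(i < N) \sum_(j < N | (i + j <= N - 2)%N) (T i.+1 j - T i j).
  rewrite (rcap_odd_even _ _ _ (a := a) (b := b)) //; last first.
    by rewrite -aE; congr (_ * _)%N; lia.
  rewrite -sumrN; apply: eq_bigr => i _.
  rewrite -sumrN; apply: eq_bigr => j ij; rewrite /T.
  have [e NE] : exists e, (N = e + j.+1)%N by exists (N - j.+1)%N; lia.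
  have -> : (N.-1 - j = e)%N by lia.
  have -> : (N - j = e.+1)%N by lia.
  rewrite (dcochain_even _ _ op aE) !(slice_slice, afac_slice); [|lia..].
  rewrite (linB ((ract_bilin P).1 _)) (linB ((tpureA_bilin M P).2 _)).
  rewrite (linB (h_lin _)) [_ *> phi _ <* _]lractA -tpureA_balanced !ract_cat; [|lia..].
  rewrite lractA ract_cat; [|lia..].
  rewrite opprB; index_congr.
by rewrite L0 L1 L2 telescope_tri_left // sumrB opprB addrC subrK.
Qed.

(** The sign $(-1)^{pq}$ of the product is $-1$ on the left-hand side and $1$ in the
    product with the differential of the cochain, whose degree is even. *)
Lemma rcap_dchain_odd_odd : odd p -> odd q ->
  rcap p q phi (dchain (q - p) h) m x =
  dchain q (rcap p q.-1 phi h) m x - rcap p.+1 q (dcochain p phi) h m x.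
Proof.
move=> op oq; have [r qE] : exists r, q./2 = (p./2 + r.+1)%N.
  by exists (q./2 - p./2).-1; lia.
have [a aE] : exists a, (N * p./2)%N = a by exists (N * p./2)%N.
have [b bE] : exists b, (N * r)%N = b by exists (N * r)%N.
have qab : (N * q./2 = a + b + N)%N by rewrite qE mulnDr mulnS aE bE; lia.
have nup : nu p = a.+1.
  have -> : p = p./2.*2.+1 by lia.
  by rewrite nu_doubleS aE.
have nuq : nu q = (a + b + N).+1.
  have -> : q = q./2.*2.+1 by lia.
  by rewrite nu_doubleS qab.
pose T i j := h
  (tpureA (afac x (a + b + (N - j)).+2 (a + b + N).+1 *> (m <* afac x 1 i))
          (phi (slice x i.+1 (a + i).+1) <* afac x (a + i).+2 (a + (N - j))))
  (slice x (a + (N - j)).+1 (a + b + (N - j)).+1).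
have L0 : rcap p q phi (dchain (q - p) h) m x = - \sum_(j < N) T 0%N j.
  rewrite -(reverse_sum N (T 0%N)) (rcap_other _ _ _ _ _ nup nuq); last first.
    by rewrite oq andbF.
  rewrite -signr_odd oddM op oq scaleN1r; congr (- _).
  have dE : (q - p = r.+1.*2)%N by lia.
  rewrite (dchain_even _ _ (c := b)); first last.
  - by rewrite dE doubleK mulnS bE addnC.
  - by rewrite dE odd_double.
  apply: eq_bigr => i _; have iN := ltn_ord i.
  rewrite !(slice_slice, afac_slice); [| lia..].
  rewrite ract_tpureA lact_tpureA /T [m <* _]ract_nil //.
  index_congr.
have L1 : dchain q (rcap p q.-1 phi h) m x =
    \sum_(i < N) \sum_(j < N | (i + j <= N - 2)%N) (T i.+1 j - T i j.+1).
  rewrite (dchain_odd _ _ _ oq qab).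
  have oq1 : ~~ odd q.-1 by lia.
  have qab1 : (N * q.-1./2 = a + b + N)%N.
    have -> : q.-1 = q./2.*2 by lia.
    by rewrite doubleK.
  rewrite !(rcap_odd_even _ _ _ _ op oq1 aE qab1).
  rewrite -sumrB; apply: eq_bigr => i _.
  rewrite -sumrB; apply: eq_bigr => j ij; rewrite /T.
  have [e NE] : exists e, (N = e + j.+1)%N by exists (N - j.+1)%N; lia.
  have -> : (N.-1 - j = e)%N by lia.
  have -> : (N - j = e.+1)%N by lia.
  have -> : (N - j.+1 = e)%N by lia.
  rewrite !(slice_slice, afac_slice); [|lia..].
  rewrite ract_cat // lractA lact_cat; [|lia..].
  index_congr.
have L2 : rcap p.+1 q (dcochain p phi) h m x = \sum_(i < N) T i 0%N.
  rewrite (rcap_other _ _ _ (a := a + N) _ _ _ nuq); first last.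
  - have -> : p.+1 = p./2.+1.*2 by lia.
    by rewrite nu_double mulnS aE addnC.
  - by rewrite oq andbF.
  rewrite -signr_odd oddM oddS op scale1r.
  rewrite (dcochain_odd _ _ op aE) (lin_sum ((tpureA_bilin M P).2 _)).
  rewrite (lin_sum (h_lin _)); apply: eq_bigr => i _; have iN := ltn_ord i.
  rewrite !(slice_slice, afac_slice); [| lia..].
  rewrite -tpureA_balanced /T lact_nil; last by lia.
  index_congr.
by rewrite L0 L1 L2 telescope_tri_diag // addrAC subrr add0r.
Qed.

Lemma rcap_dchain_even_odd : ~~ odd p -> odd q ->
  rcap p q phi (dchain (q - p) h) m x =
  dchain q (rcap p q.-1 phi h) m x - rcap p.+1 q (dcochain p phi) h m x.
Proof.
move=> op oq; have [r qE] : exists r, q./2 = (p./2 + r)%N.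
  by exists (q./2 - p./2)%N; lia.
have [a aE] : exists a, (N * p./2)%N = a by exists (N * p./2)%N.
have [b bE] : exists b, (N * r)%N = b by exists (N * r)%N.
have qab : (N * q./2 = a + b)%N by rewrite qE mulnDr aE bE.
have nup : nu p = a.
  have -> : p = p./2.*2 by lia.
  by rewrite nu_double.
have nuq : nu q = (a + b).+1.
  have -> : q = q./2.*2.+1 by lia.
  by rewrite nu_doubleS qab.
have dE : (q - p = r.*2.+1)%N by lia.
rewrite (rcap_other _ _ _ _ _ nup nuq); last by rewrite oq andbF.
rewrite -signr_odd oddM (negbTE op) scale1r.
rewrite (dchain_odd _ _ _ (c := b)); first last.
- by rewrite dE /= uphalf_double bE.
- by rewrite dE /= odd_double.
rewrite (rcap_other _ _ _ (a := a.+1) _ _ _ nuq); first last.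
- have -> : p.+1 = p./2.*2.+1 by lia.
  by rewrite nu_doubleS aE.
- by rewrite oq andbF.
rewrite -signr_odd oddM oddS op oq scaleN1r opprK.
rewrite (dcochain_even _ _ op aE) (dchain_odd _ _ _ oq qab).
have nuq1 : nu q.-1 = (a + b)%N.
  have -> : q.-1 = q./2.*2 by lia.
  by rewrite nu_double qab.
have opq1 : ~~ (odd p && ~~ odd q.-1) by rewrite (negbTE op).
rewrite !(rcap_other _ _ _ _ opq1 nup nuq1).
rewrite -signr_odd oddM (negbTE op) !scale1r.
rewrite !(slice_slice, afac_slice); [|lia..].
rewrite ract_tpureA lact_tpureA (linB ((tpureA_bilin M P).2 _)).
rewrite (linB (h_lin _)) -tpureA_balanced !add0n !addn0 !addSn !add0n !addn1 !addnS.
by rewrite [RHS]addrC addrA subrK.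
Qed.

(** The outer differential acts on the letters beyond [phi], which gives differences in
    [j]. *)
Lemma rcap_dchain_odd_even : odd p -> ~~ odd q ->
  rcap p q phi (dchain (q - p) h) m x =
  dchain q (rcap p q.-1 phi h) m x + rcap p.+1 q (dcochain p phi) h m x.
Proof.
move=> op oq; have [r qE] : exists r, q./2 = (p./2 + r.+1)%N.
  by exists (q./2 - p./2).-1; lia.
have [a aE] : exists a, (N * p./2)%N = a by exists (N * p./2)%N.
have [b bE] : exists b, (N * r)%N = b by exists (N * r)%N.
have qab : (N * q./2 = a + b + N)%N by rewrite qE mulnDr mulnS aE bE; lia.
pose T i j := h
  (tpureA (afac x (a + b + (N - j)).+1 (a + b + N) *> (m <* afac x 1 i))
          (phi (slice x i.+1 (a + i).+1) <* afac x (a + i).+2 (a + (N - j))))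
  (slice x (a + (N - j)).+1 (a + b + (N - j))).
have L0 : rcap p q phi (dchain (q - p) h) m x =
    - \sum_(i < N) \sum_(j < N | (i + j <= N - 2)%N) (T i j.+1 - T i j).
  rewrite (rcap_odd_even _ _ _ (a := a) (b := b)) // -sumrN.
  apply: eq_bigr => i _; rewrite -sumrN; apply: eq_bigr => j ij; rewrite /T.
  have [e NE] : exists e, (N = e + j.+1)%N by exists (N - j.+1)%N; lia.
  have -> : (N.-1 - j = e)%N by lia.
  have -> : (N - j = e.+1)%N by lia.
  have -> : (N - j.+1 = e)%N by lia.
  have dE : (q - p = r.*2.+1)%N by lia.
  rewrite (dchain_odd _ _ _ (c := b)); first last.
  - by rewrite dE /= uphalf_double bE.
  - by rewrite dE /= odd_double.
  rewrite !(slice_slice, afac_slice); [|lia..].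
  rewrite ract_tpureA lact_tpureA ract_cat; [|lia..].
  rewrite lact_cat; [|lia..].
  rewrite opprB; index_congr.
have L1 : dchain q (rcap p q.-1 phi h) m x = - \sum_(i < N) T i (N.-1 - i)%N.
  rewrite (dchain_even _ _ (c := a + b)) // -sumrN.
  apply: eq_bigr => i _; have iN := ltn_ord i.
  have oq1 : odd q.-1 by lia.
  rewrite (rcap_other _ _ _ (a := a.+1) (n := (a + b).+1)); first last.
  - have -> : q.-1 = ((p./2 + r).*2.+1)%N by lia.
    by rewrite nu_doubleS mulnDr aE bE.
  - have -> : p = p./2.*2.+1 by lia.
    by rewrite nu_doubleS aE.
  - by rewrite oq1 andbF.
  rewrite -signr_odd oddM op oq1 scaleN1r.
  rewrite !slice_slice; [| lia..].
  rewrite /T [X in _ = - h (tpureA _ X) _]ract_nil; last by lia.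
  index_congr.
have L2 : rcap p.+1 q (dcochain p phi) h m x = \sum_(i < N) T i 0%N.
  rewrite (rcap_other _ _ _ (a := a + N) (n := a + b + N)); first last.
  - have -> : q = q./2.*2 by lia.
    by rewrite nu_double qab.
  - have -> : p.+1 = p./2.+1.*2 by lia.
    by rewrite nu_double mulnS aE addnC.
  - by rewrite /= op.
  rewrite -signr_odd oddM oddS op scale1r.
  rewrite (dcochain_odd _ _ op aE) (lin_sum ((tpureA_bilin M P).2 _)).
  rewrite (lin_sum (h_lin _)); apply: eq_bigr => i _; have iN := ltn_ord i.
  rewrite !(slice_slice, afac_slice); [| lia..].
  rewrite -tpureA_balanced /T lact_nil; last by lia.
  index_congr.
by rewrite L0 L1 L2 telescope_tri_right // sumrB opprB addrC.
Qed.

End RightIdentity.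

Section Leibniz.
Variables (k : fieldType) (V : lmodType k) (N : nat) (R : homog_rel V N).

Lemma lcap_dchain (M P : bimodule (homalg R)) (F : lmodType k) p q
    (phi : seq V -> P) (h : tensA P M -> seq V -> F) m x :
  (forall y, linear (h^~ y)) -> (p < q)%N ->
  lcap p q phi (dchain (q - p) h) m x =
  lcap p.+1 q (dcochain p phi) h m x + (-1) ^+ p *: dchain q (lcap p q.-1 phi h) m x.
Proof.
move=> h_lin pq; rewrite -signr_odd.
case/boolP: (odd p) => op; case/boolP: (odd q) => oq; rewrite ?scaleN1r ?scale1r.
- exact: lcap_dchain_odd_odd.
- exact: lcap_dchain_odd_even.
- exact: lcap_dchain_even_odd.
- exact: lcap_dchain_even_even.
Qed.

Lemma rcap_dchain (M P : bimodule (homalg R)) (F : lmodType k) p q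
    (phi : seq V -> P) (h : tensA M P -> seq V -> F) m x :
  (forall y, linear (h^~ y)) -> (p < q)%N ->
  rcap p q phi (dchain (q - p) h) m x =
  dchain q (rcap p q.-1 phi h) m x + (-1) ^+ q *: rcap p.+1 q (dcochain p phi) h m x.
Proof.
move=> h_lin pq; rewrite -signr_odd.
case/boolP: (odd p) => op; case/boolP: (odd q) => oq; rewrite ?scaleN1r ?scale1r.
- exact: rcap_dchain_odd_odd.
- exact: rcap_dchain_odd_even.
- exact: rcap_dchain_even_odd.
- exact: rcap_dchain_even_even.
Qed.

End Leibniz.

(** * From bare words to chains *)

Section Removal.
Variables (k : fieldType) (V : lmodType k) (N : nat) (R : homog_rel V N).
Local Notation afac := (afac R).
Local Notation nu := (nu N).

Let N2 : (2 <= N)%N := rel_degree R.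

(** The arguments [h] and [phi] for which the operators on bare words are the
    word formulas of the differentials and the cap products. *)
Definition pure_word (M : bimodule (homalg R)) d (m : M) (y : seq V) : chain M d :=
  tpure m (koszulW_proj R (nu d) (tword y)).

Definition cochain_word (P : bimodule (homalg R)) p (f : cochain P p) (y : seq V) : P :=
  f (koszulW_proj R (nu p) (tword y)).

Lemma bK_chain_wordE (M : bimodule (homalg R)) q :
  @bK_chain_word _ _ _ R M q = dchain q (@pure_word M q.-1).
Proof.
apply/funext => m; apply/funext => x.
by rewrite /bK_chain_word /dchain; case: ifP.
Qed.

Lemma capl_wordE (M P : bimodule (homalg R)) p q (f : cochain P p) :
  @capl_word _ _ _ R M P p q f = lcap p q (cochain_word f) (@pure_word _ (q - p)).
Proof.
by apply/funext => m; apply/funext => x; rewrite /capl_word /lcap; case: ifP.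
Qed.

Lemma capr_wordE (M P : bimodule (homalg R)) p q (f : cochain P p) :
  @capr_word _ _ _ R M P p q f = rcap p q (cochain_word f) (@pure_word _ (q - p)).
Proof.
by apply/funext => m; apply/funext => x; rewrite /capr_word /rcap; case: ifP.
Qed.

Section ChainValued.
Variables (M : bimodule (homalg R)) (F : lmodType k) (d : nat) (h : M -> seq V -> F).
Hypothesis h_mult : forall m, multilinear (nu d) (h m).
Hypothesis h_lin : forall x, linear (h^~ x).

Lemma chain_ext_tpure m (w : koszulW R (nu d)) :
  chain_ext h (tpure m w) = word_ext (nu d) (h m) (val w).
Proof. by rewrite /chain_ext (tlift_pure (chain_ext_bilin h_mult h_lin)). Qed.

(** The instance of [eqW_proj] for a map of chains that is applied to
    $\mu(x) \otimes x_i \ldots x_j$, where $\mu(x)$ involves the other letters. *)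
Lemma eqW_chain (D : pred nat) n u i j (mu : seq V -> M) :
  i = u.+1 -> j = (u + nu d)%N -> (u + nu d <= n)%N ->
  (forall l, (l < n)%N -> D l = ~~ (u <= l < u + nu d)%N) -> linear_at D mu ->
  eqW R n (fun x => chain_ext h (pure_word d (mu x) (slice x i j)))
          (fun x => h (mu x) (slice x i j)).
Proof.
move=> -> -> un DE mu_lin.
apply: (eqW_trans (h := fun x => word_ext (nu d) (h (mu x))
    (val (wfac R (nu d) x u.+1 (u + nu d))))).
  by apply: eqW_word => x _; rewrite chain_ext_tpure.
refine (@eqW_proj _ _ _ R F D n u (nu d) (fun x => h (mu x)) un DE _ _) => [x|y].
  exact: h_mult.
exact: (linear_at_comp (h_lin y) mu_lin).
Qed.

End ChainValued.

(** Applying [h] after the differential of chains is the formal composite on $W_n$: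
    each term is an instance of [eqW_chain]. *)
Lemma eqW_dchain (M : bimodule (homalg R)) (F : lmodType k) q
    (h : M -> seq V -> F) (m : M) :
  (forall m, multilinear (nu q.-1) (h m)) -> (forall x, linear (h^~ x)) ->
  (0 < q)%N ->
  eqW R (nu q) (fun x => chain_ext h (bK_chain_word q m x)) (dchain q h m).
Proof.
move=> h_mult h_lin q0; have cl := chain_ext_linear h_mult h_lin.
have al := afac_linear_at R; have ml : linear_at pred0 (fun _ : seq V => m : M) by [].
case/boolP: (odd q) => oq.
  have qE : q = q./2.*2.+1 by lia.
  have [c cE] : exists c, (N * q./2)%N = c by exists (N * q./2)%N.
  have nuq : nu q = c.+1 by rewrite qE nu_doubleS cE.
  have nuq1 : nu q.-1 = c by rewrite qE nu_double cE.
  apply: (eqW_trans (h := fun x =>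
      chain_ext h (pure_word q.-1 (m <* afac x 1 1) (slice x 2 c.+1))
      - chain_ext h (pure_word q.-1 (afac x c.+1 c.+1 *> m) (slice x 1 c)))).
    apply: eqW_word => x _; rewrite -(linB cl) bK_chain_wordE.
    by rewrite (dchain_odd _ _ _ oq cE).
  apply: (eqW_trans (h := fun x => h (m <* afac x 1 1) (slice x 2 c.+1)
      - h (afac x c.+1 c.+1 *> m) (slice x 1 c))); last first.
    by apply: eqW_word => x _; rewrite (dchain_odd x m h oq cE).
  apply: eqWD; last apply: eqWN; rewrite nuq.
    apply: (eqW_chain h_mult h_lin (u := 1)) 
      (linear_at_bilin (ract_bilin M) ml (al _ _) _) => //=; try lia.
  apply: (eqW_chain h_mult h_lin (u := 0))
    (linear_at_bilin (lact_bilin M) (al _ _) ml _) => //=; try lia.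
have [b cE] : exists b, (N * q./2)%N = (b + N)%N.
  by exists (N * q./2.-1)%N; rewrite -mulnSr; congr (_ * _)%N; lia.
have nuq : nu q = (b + N)%N.
  have -> : q = q./2.*2 by lia.
  by rewrite nu_double.
have nuq1 : nu q.-1 = b.+1.
  have -> : q.-1 = q./2.-1.*2.+1 by lia.
  rewrite nu_doubleS; congr _.+1; apply/eqP; rewrite -(eqn_add2r N) -cE -mulnSr.
  by apply/eqP; congr (_ * _)%N; lia.
apply: (eqW_trans (h := fun x => \sum_(i < N) chain_ext h (pure_word q.-1
    (afac x (b + i).+2 (b + N) *> (m <* afac x 1 i)) (slice x i.+1 (b + i).+1)))).
  apply: eqW_word => x _; rewrite -(lin_sum cl) bK_chain_wordE.
  by rewrite (dchain_even _ _ _ oq cE).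
apply: (eqW_trans (h := fun x => \sum_(i < N) h
    (afac x (b + i).+2 (b + N) *> (m <* afac x 1 i)) (slice x i.+1 (b + i).+1)));
  last first.
  by apply: eqW_word => x _; rewrite (dchain_even x m h oq cE).
apply: eqW_sum => i _; have iN := ltn_ord i; rewrite nuq.
apply: (eqW_chain h_mult h_lin (u := i)) (linear_at_bilin (lact_bilin M) (al _ _)
  (linear_at_bilin (ract_bilin M) ml (al _ _) _) _) => //=; try lia.
Qed.

Section Caps.
Variables (M P : bimodule (homalg R)) (p q : nat) (f : cochain P p) (m : M).

Lemma odd_even_sizes : (p < q)%N -> odd p -> ~~ odd q ->
  exists a b, [/\ (N * p./2)%N = a, (N * q./2)%N = (a + b + N)%N,
    nu p = a.+1, nu q = (a + b + N)%N & nu (q - p) = b.+1].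
Proof.
move=> pq op oq; have [r qE] : exists r, q./2 = (p./2 + r.+1)%N.
  by exists (q./2 - p./2).-1; lia.
exists (N * p./2)%N, (N * r)%N.
have qab : (N * q./2 = N * p./2 + N * r + N)%N by rewrite qE mulnDr mulnS; lia.
split=> //.
- have {1}-> : p = p./2.*2.+1 by lia.
  by rewrite nu_doubleS.
- have {1}-> : q = q./2.*2 by lia.
  by rewrite nu_double.
- have -> : (q - p = r.*2.+1)%N by lia.
  by rewrite nu_doubleS.
Qed.

Lemma eqW_lcap (F : lmodType k) (h : tensA P M -> seq V -> F) :
  (forall m, multilinear (nu (q - p)) (h m)) -> (forall x, linear (h^~ x)) ->
  (p <= q)%N ->
  eqW R (nu q) (fun x => chain_ext h (capl_word q f m x))
    (lcap p q (cochain_word f) h m).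
Proof.
move=> h_mult h_lin pq; have cl := chain_ext_linear h_mult h_lin.
have ml : linear_at pred0 (fun _ : seq V => m : M) by [].
have ab := tpureA_bilin P M.
case/boolP: (odd p && ~~ odd q) => opq; last first.
  have nE := nu_sub N pq (negbTE opq).
  apply: (eqW_trans (h := fun x => chain_ext h (pure_word (q - p)
      (tpureA (cochain_word f (slice x (nu (q - p)).+1 (nu q))) m)
      (slice x 1 (nu (q - p)))))).
    apply: eqW_word => x _; rewrite capl_wordE.
    by rewrite (lcap_other _ _ _ _ opq erefl erefl).
  apply: (eqW_trans (h := fun x => h (tpureA (cochain_word f
      (slice x (nu (q - p)).+1 (nu q))) m) (slice x 1 (nu (q - p))))); last first.
    by apply: eqW_word => x _; rewrite (lcap_other _ _ _ _ opq erefl erefl).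
  apply: (eqW_chain h_mult h_lin (u := 0)) (linear_at_bilin ab
     (@cochain_on _ _ _ _ _ _ f (nu (q - p)) (nu q) _ _ erefl erefl _) ml _) => //=; lia.
have [op oq] := andP opq.
have [|a [b [aE qab nup nuq nuqp]]] := odd_even_sizes _ op oq; first by lia.
pose mu i j (x : seq V) := tpureA (afac x (b + i).+2 (b + (N.-1 - j)) *>
      cochain_word f (slice x (b + (N.-1 - j)).+1 (a + b + (N - j))))
   (afac x (a + b + (N - j)).+1 (a + b + N) *> (m <* afac x 1 i)).
apply: (eqW_trans (h := fun x => - \sum_(i < N) \sum_(j < N | (i + j <= N - 2)%N)
    chain_ext h (pure_word (q - p) (mu i j x) (slice x i.+1 (b + i).+1)))).
  apply: eqW_word => x _.
  rewrite capl_wordE (lcap_odd_even _ _ _ _ op oq aE qab) (linN cl) (lin_sum cl).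
  by congr (- _); apply: eq_bigr => i _; rewrite (lin_sum cl).
apply: (eqW_trans (h := fun x => - \sum_(i < N) \sum_(j < N | (i + j <= N - 2)%N)
    h (mu i j x) (slice x i.+1 (b + i).+1))); last first.
  by apply: eqW_word => x _; rewrite (lcap_odd_even _ _ _ _ op oq aE qab).
apply: eqWN; apply: eqW_sum => i _; apply: eqW_sum => j ij.
have iN := ltn_ord i; have jN := ltn_ord j.
rewrite nuq.
have mu_lin : linear_at
    (fun l => (l < i) || (i + nu (q - p) <= l < a + b + N))%N (mu i j).
  refine (linear_at_eq _ (linear_at_bilin ab
    (linear_at_bilin (lact_bilin P)
      (@afac_on _ _ _ R (b + i).+1 (b + (N.-1 - j)) _ _ erefl erefl _)
      (@cochain_on _ _ _ _ _ _ f (b + (N.-1 - j)) (a + b + (N - j)) _ _ erefl erefl _) _)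
    (linear_at_bilin (lact_bilin M)
      (@afac_on _ _ _ R (a + b + (N - j)) (a + b + N) _ _ erefl erefl _)
      (linear_at_bilin (ract_bilin M) ml (@afac_on _ _ _ R 0 i _ _ erefl erefl _) _) _) _));
  rewrite /=; try lia.
  by move=> l /=; lia.
apply: (eqW_chain h_mult h_lin (u := i) _ _ _ _ mu_lin) => //; lia.
Qed.

Lemma eqW_rcap (F : lmodType k) (h : tensA M P -> seq V -> F) :
  (forall m, multilinear (nu (q - p)) (h m)) -> (forall x, linear (h^~ x)) ->
  (p <= q)%N ->
  eqW R (nu q) (fun x => chain_ext h (capr_word q f m x))
    (rcap p q (cochain_word f) h m).
Proof.
move=> h_mult h_lin pq; have cl := chain_ext_linear h_mult h_lin.
have ml : linear_at pred0 (fun _ : seq V => m : M) by [].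
have ab := tpureA_bilin M P.
case/boolP: (odd p && ~~ odd q) => opq; last first.
  have nE := nu_sub N pq (negbTE opq).
  apply: (eqW_trans (h := fun x => (-1) ^+ (p * q) *: chain_ext h (pure_word (q - p)
      (tpureA m (cochain_word f (slice x 1 (nu p)))) (slice x (nu p).+1 (nu q))))).
    apply: eqW_word => x _; rewrite capr_wordE.
    by rewrite (rcap_other _ _ _ _ opq erefl erefl) (linZ cl).
  apply: (eqW_trans (h := fun x => (-1) ^+ (p * q) *: h
      (tpureA m (cochain_word f (slice x 1 (nu p)))) (slice x (nu p).+1 (nu q))));
    last first.
    by apply: eqW_word => x _; rewrite (rcap_other _ _ _ _ opq erefl erefl).
  apply: eqWZ; apply: (eqW_chain h_mult h_lin (u := nu p)) (linear_at_bilin ab ml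
     (@cochain_on _ _ _ _ _ _ f 0 (nu p) _ _ erefl erefl _) _) => //=; lia.
have [op oq] := andP opq.
have [|a [b [aE qab nup nuq nuqp]]] := odd_even_sizes _ op oq; first by lia.
pose mu i j (x : seq V) := tpureA
  (afac x (a + b + (N - j)).+1 (a + b + N) *> (m <* afac x 1 i))
  (cochain_word f (slice x i.+1 (a + i).+1) <* afac x (a + i).+2 (a + (N.-1 - j))).
apply: (eqW_trans (h := fun x => \sum_(i < N) \sum_(j < N | (i + j <= N - 2)%N)
    chain_ext h (pure_word (q - p) (mu i j x)
      (slice x (a + (N.-1 - j)).+1 (a + b + (N - j)))))).
  apply: eqW_word => x _; rewrite capr_wordE.
  rewrite (rcap_odd_even _ _ _ _ op oq aE qab) (lin_sum cl).
  by apply: eq_bigr => i _; rewrite (lin_sum cl).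
apply: (eqW_trans (h := fun x => \sum_(i < N) \sum_(j < N | (i + j <= N - 2)%N)
    h (mu i j x) (slice x (a + (N.-1 - j)).+1 (a + b + (N - j))))); last first.
  by apply: eqW_word => x _; rewrite (rcap_odd_even _ _ _ _ op oq aE qab).
apply: eqW_sum => i _; apply: eqW_sum => j ij.
have iN := ltn_ord i; have jN := ltn_ord j.
rewrite nuq.
have mu_lin : linear_at (fun l => (l < a + (N.-1 - j)) ||
    (a + (N.-1 - j) + nu (q - p) <= l < a + b + N))%N (mu i j).
  refine (linear_at_eq _ (linear_at_bilin ab
    (linear_at_bilin (lact_bilin M)
      (@afac_on _ _ _ R (a + b + (N - j)) (a + b + N) _ _ erefl erefl _)
      (linear_at_bilin (ract_bilin M) ml (@afac_on _ _ _ R 0 i _ _ erefl erefl _) _) _)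
    (linear_at_bilin (ract_bilin P)
      (@cochain_on _ _ _ _ _ _ f i (a + i).+1 _ _ erefl erefl _)
      (@afac_on _ _ _ R (a + i).+1 (a + (N.-1 - j)) _ _ erefl erefl _) _) _));
  rewrite /=; try lia.
  by move=> l /=; lia.
apply: (eqW_chain h_mult h_lin (u := a + (N.-1 - j)) _ _ _ _ mu_lin) => //; lia.
Qed.

End Caps.

Section CochainReplacement.
Variables (M P : bimodule (homalg R)) (p q : nat) (f : cochain P p) (m : M).

(** The instance of [eqW_proj] for the value of the differential of a cochain inside a
    formula [L] that is linear in this value. *)
Lemma eqW_cochain (F : lmodType k) (D : pred nat) n u i j (L : seq V -> P -> F) :
  i = u.+1 -> j = (u + nu p.+1)%N -> (u + nu p.+1 <= n)%N ->
  (forall l, (l < n)%N -> D l = ~~ (u <= l < u + nu p.+1)%N) ->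
  (forall x, linear (L x)) -> (forall y, linear_at D (L^~ y)) ->
  eqW R n (fun x => L x (cochain_word (bK_cochain f) (slice x i j)))
          (fun x => L x (bK_cochain_word f (slice x i j))).
Proof.
move=> -> -> un DE L_lin LD.
apply: (eqW_trans (h := fun x => word_ext (nu p.+1)
    (fun y => L x (bK_cochain_word f y))
    (val (wfac R (nu p.+1) x u.+1 (u + nu p.+1))))).
  by apply: eqW_word => x _; rewrite word_ext_comp.
refine (@eqW_proj _ _ _ R F D n u (nu p.+1)
  (fun x y => L x (bK_cochain_word f y)) un DE _ _) => [x|y]; last exact: LD.
by move=> s t c v v' e; rewrite bK_cochain_word_mult // L_lin.
Qed.

Lemma eqW_lcap_cochain : (p < q)%N ->
  eqW R (nu q) (capl_word q (bK_cochain f) m)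
    (lcap p.+1 q (bK_cochain_word f) (pure_word (q - p.+1)) m).
Proof.
move=> pq; have [tl tr] := tpure_bilin (tensA P M) (koszulW R (nu (q - p.+1))).
have ml : linear_at pred0 (fun _ : seq V => m : M) by [].
have [al ar] := tpureA_bilin P M.
case/boolP: (odd p.+1 && ~~ odd q) => opq; last first.
  have nE := nu_sub N pq (negbTE opq); pose d := nu (q - p.+1).
  pose L (x : seq V) (y : P) := pure_word (q - p.+1) (tpureA y m) (slice x 1 d).
  apply: (eqW_trans (h := fun x =>
      L x (cochain_word (bK_cochain f) (slice x d.+1 (nu q))))).
    apply: eqW_word => x _; rewrite capl_wordE.
    by rewrite (lcap_other _ _ _ _ opq erefl erefl).
  apply: (eqW_trans (h := fun x => L x (bK_cochain_word f (slice x d.+1 (nu q)))));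
    last first.
    by apply: eqW_word => x _; rewrite (lcap_other _ _ _ _ opq erefl erefl).
  have LD y : linear_at (fun l => l < d)%N (L^~ y).
    exact: (linear_at_comp (tr (tpureA y m))
      (@wfac_on _ _ _ R d 0 d _ _ erefl erefl (leq0n d))).
  refine (@eqW_cochain _ _ (nu q) d _ _ L _ _ _ _ _ LD) => // [||x]; try by rewrite /d; lia.
  by move=> c y z; rewrite /L /pure_word al tl.
have [op oq] := andP opq.
have [|a [b [aE qab nup nuq nuqp]]] := odd_even_sizes _ op oq; first by lia.
pose L i j (x : seq V) (y : P) := pure_word (q - p.+1)
  (tpureA (afac x (b + i).+2 (b + (N.-1 - j)) *> y)
     (afac x (a + b + (N - j)).+1 (a + b + N) *> (m <* afac x 1 i)))
  (slice x i.+1 (b + i).+1).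
apply: (eqW_trans (h := fun x => - \sum_(i < N) \sum_(j < N | (i + j <= N - 2)%N)
    L i j x (cochain_word (bK_cochain f)
      (slice x (b + (N.-1 - j)).+1 (a + b + (N - j)))))).
  by apply: eqW_word => x _; rewrite capl_wordE (lcap_odd_even _ _ _ _ op oq aE qab).
apply: (eqW_trans (h := fun x => - \sum_(i < N) \sum_(j < N | (i + j <= N - 2)%N)
    L i j x (bK_cochain_word f
      (slice x (b + (N.-1 - j)).+1 (a + b + (N - j)))))); last first.
  by apply: eqW_word => x _; rewrite (lcap_odd_even _ _ _ _ op oq aE qab).
apply: eqWN; apply: eqW_sum => i _; apply: eqW_sum => j ij.
have iN := ltn_ord i; have jN := ltn_ord j.
rewrite nuq.
have LD y : linear_at (fun l => (l < b + (N.-1 - j)) ||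
    (b + (N.-1 - j) + nu p.+1 <= l < a + b + N))%N ((L i j)^~ y).
  refine (linear_at_eq _ (linear_at_bilin (tpure_bilin _ _)
    (linear_at_bilin (tpureA_bilin P M)
      (linear_at_comp ((lact_bilin P).1 y)
        (@afac_on _ _ _ R (b + i).+1 (b + (N.-1 - j)) _ _ erefl erefl _))
      (linear_at_bilin (lact_bilin M)
        (@afac_on _ _ _ R (a + b + (N - j)) (a + b + N) _ _ erefl erefl _)
        (linear_at_bilin (ract_bilin M) ml (@afac_on _ _ _ R 0 i _ _ erefl erefl _) _) _) _)
    (@wfac_on _ _ _ R _ i (b + i).+1 _ _ erefl erefl _) _));
  rewrite /=; try lia.
  by move=> l /=; lia.
refine (@eqW_cochain _ _ (a + b + N) (b + (N.-1 - j)) _ _ (L i j) _ _ _ _ _ LD)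
  => // [|||x]; try lia.
by move=> c y z; rewrite /L /pure_word (lact_bilin P).2 al tl.
Qed.

Lemma eqW_rcap_cochain : (p < q)%N ->
  eqW R (nu q) (capr_word q (bK_cochain f) m)
    (rcap p.+1 q (bK_cochain_word f) (pure_word (q - p.+1)) m).
Proof.
move=> pq; have [tl tr] := tpure_bilin (tensA M P) (koszulW R (nu (q - p.+1))).
have ml : linear_at pred0 (fun _ : seq V => m : M) by [].
have [al ar] := tpureA_bilin M P.
case/boolP: (odd p.+1 && ~~ odd q) => opq; last first.
  have nE := nu_sub N pq (negbTE opq).
  pose L (x : seq V) (y : P) :=
    pure_word (q - p.+1) (tpureA m y) (slice x (nu p.+1).+1 (nu q)).
  apply: (eqW_trans (h := fun x => (-1) ^+ (p.+1 * q) *: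
      L x (cochain_word (bK_cochain f) (slice x 1 (nu p.+1))))).
    apply: eqW_word => x _; rewrite capr_wordE.
    by rewrite (rcap_other _ _ _ _ opq erefl erefl).
  apply: (eqW_trans (h := fun x => (-1) ^+ (p.+1 * q) *:
      L x (bK_cochain_word f (slice x 1 (nu p.+1))))); last first.
    by apply: eqW_word => x _; rewrite (rcap_other _ _ _ _ opq erefl erefl).
  have pq' : (nu p.+1 <= nu q)%N by lia.
  have LD y : linear_at (fun l => nu p.+1 <= l < nu q)%N (L^~ y).
    exact: (linear_at_comp (tr (tpureA m y))
      (@wfac_on _ _ _ R (nu (q - p.+1)) (nu p.+1) (nu q) _ _ erefl erefl pq')).
  apply: eqWZ; refine (@eqW_cochain _ _ (nu q) 0 _ _ L _ _ _ _ _ LD) => // [|x]; try lia.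
  by move=> c y z; rewrite /L /pure_word ar tl.
have [op oq] := andP opq.
have [|a [b [aE qab nup nuq nuqp]]] := odd_even_sizes _ op oq; first by lia.
pose L i j (x : seq V) (y : P) := pure_word (q - p.+1)
  (tpureA (afac x (a + b + (N - j)).+1 (a + b + N) *> (m <* afac x 1 i))
     (y <* afac x (a + i).+2 (a + (N.-1 - j))))
  (slice x (a + (N.-1 - j)).+1 (a + b + (N - j))).
apply: (eqW_trans (h := fun x => \sum_(i < N) \sum_(j < N | (i + j <= N - 2)%N)
    L i j x (cochain_word (bK_cochain f) (slice x i.+1 (a + i).+1)))).
  by apply: eqW_word => x _; rewrite capr_wordE (rcap_odd_even _ _ _ _ op oq aE qab).
apply: (eqW_trans (h := fun x => \sum_(i < N) \sum_(j < N | (i + j <= N - 2)%N)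
    L i j x (bK_cochain_word f (slice x i.+1 (a + i).+1)))); last first.
  by apply: eqW_word => x _; rewrite (rcap_odd_even _ _ _ _ op oq aE qab).
apply: eqW_sum => i _; apply: eqW_sum => j ij.
have iN := ltn_ord i; have jN := ltn_ord j.
rewrite nuq.
have LD y : linear_at (fun l => (l < i) || (i + nu p.+1 <= l < a + b + N))%N
    ((L i j)^~ y).
  refine (linear_at_eq _ (linear_at_bilin (tpure_bilin _ _)
    (linear_at_bilin (tpureA_bilin M P)
      (linear_at_bilin (lact_bilin M)
        (@afac_on _ _ _ R (a + b + (N - j)) (a + b + N) _ _ erefl erefl _)
        (linear_at_bilin (ract_bilin M) ml (@afac_on _ _ _ R 0 i _ _ erefl erefl _) _) _)
      (linear_at_comp ((ract_bilin P).2 y)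
        (@afac_on _ _ _ R (a + i).+1 (a + (N.-1 - j)) _ _ erefl erefl _)) _)
    (@wfac_on _ _ _ R _ (a + (N.-1 - j)) (a + b + (N - j)) _ _ erefl erefl _) _));
  rewrite /=; try lia.
  by move=> l /=; lia.
refine (@eqW_cochain _ _ (a + b + N) i _ _ (L i j) _ _ _ _ _ LD)
  => // [|||x]; try lia.
by move=> c y z; rewrite /L /pure_word (ract_bilin P).1 ar tl.
Qed.

End CochainReplacement.
End Removal.

Section Comparison.
Variables (k : fieldType) (V : lmodType k) (N : nat) (R : homog_rel V N).
Local Notation nu := (nu N).

(** The degrees $q - (p + 1)$, $(q - 1) - p$ and $(q - p) - 1$ agree only
    propositionally, and the degree enters the formulas through [pure_word] alone. *)
Lemma chain_cast_linear (M : bimodule (homalg R)) d d' (e : d = d') :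
  linear (chain_cast (M := M) e).
Proof. by case: d' / e. Qed.

Lemma chain_cast_lcap (M P : bimodule (homalg R)) d d' (e : d = d') p q
    (phi : seq V -> P) (m : M) x :
  chain_cast e (lcap p q phi (pure_word d) m x) = lcap p q phi (pure_word d') m x.
Proof. by case: d' / e. Qed.

Lemma chain_cast_rcap (M P : bimodule (homalg R)) d d' (e : d = d') p q
    (phi : seq V -> P) (m : M) x :
  chain_cast e (rcap p q phi (pure_word d) m x) = rcap p q phi (pure_word d') m x.
Proof. by case: d' / e. Qed.

Lemma chain_cast_dchain_lcap (M P : bimodule (homalg R)) d d' (e : d = d') p q q'
    (phi : seq V -> P) (m : M) x :
  chain_cast e (dchain q (lcap p q' phi (pure_word d)) m x) =
  dchain q (lcap p q' phi (pure_word d')) m x.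
Proof. by case: d' / e. Qed.

Lemma chain_cast_dchain_rcap (M P : bimodule (homalg R)) d d' (e : d = d') p q q'
    (phi : seq V -> P) (m : M) x :
  chain_cast e (dchain q (rcap p q' phi (pure_word d)) m x) =
  dchain q (rcap p q' phi (pure_word d')) m x.
Proof. by case: d' / e. Qed.

Lemma pure_word_linear (M : bimodule (homalg R)) d (y : seq V) :
  linear ((@pure_word _ _ _ R M d)^~ y).
Proof. exact: (tpure_bilin _ _).1. Qed.

(** For $q \le p$ every term of the Leibniz formulas vanishes. *)
Section LowDegree.
Variables (M P : bimodule (homalg R)) (p q : nat) (f : cochain P p) (z : chain M q).
Hypothesis qp : (q <= p)%N.

Lemma bK_capl0 : bK_chain (capl f z) = 0.
Proof. by rewrite /bK_chain subn_eq0 qp. Qed.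
Lemma bK_capr0 : bK_chain (capr f z) = 0.
Proof. by rewrite /bK_chain subn_eq0 qp. Qed.
Lemma capl_bK_cochain0 : capl (bK_cochain f) z = 0.
Proof. by rewrite /capl ltnS qp. Qed.
Lemma capr_bK_cochain0 : capr (bK_cochain f) z = 0.
Proof. by rewrite /capr ltnS qp. Qed.

Lemma capl_bK_chain0 : capl f (bK_chain z) = 0.
Proof.
rewrite /bK_chain; case: eqVneq => [_|q0]; first exact: (lin0 (capl_linear _)).
by rewrite /capl prednK ?lt0n // qp.
Qed.
Lemma capr_bK_chain0 : capr f (bK_chain z) = 0.
Proof.
rewrite /bK_chain; case: eqVneq => [_|q0]; first exact: (lin0 (capr_linear _)).
by rewrite /capr prednK ?lt0n // qp.
Qed.

End LowDegree.

(** Each composite of two operators on $m \otimes w$, $w \in W_{\nu(q)}$, is the formal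
    composite of the two formulas evaluated on [w]. *)
Section OnPure.
Variables (M P : bimodule (homalg R)) (p q : nat) (f : cochain P p).
Variables (m : M) (w : koszulW R (nu q)).
Let phi := cochain_word f.

Lemma bK_chainE (M' : bimodule (homalg R)) d (y : chain M' d) : (0 < d)%N ->
  bK_chain y = chain_ext (@bK_chain_word _ _ _ R M' d) y.
Proof. by rewrite /bK_chain lt0n => /negbTE ->. Qed.

Lemma bK_chain_tpure : (0 < q)%N ->
  bK_chain (tpure m w) = word_ext (nu q) (bK_chain_word q m) (val w).
Proof.
move=> q0; rewrite bK_chainE // chain_ext_tpure //; last exact: bK_chain_word_linear.
by move=> m'; apply: bK_chain_word_mult.
Qed.

Lemma capl_tpure : (p <= q)%N ->
  capl f (tpure m w) = word_ext (nu q) (capl_word q f m) (val w).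
Proof.
move=> pq; rewrite /capl ltnNge pq /= chain_ext_tpure //; last exact: capl_word_linear.
by move=> m'; apply: capl_word_mult.
Qed.

Lemma capr_tpure : (p <= q)%N ->
  capr f (tpure m w) = word_ext (nu q) (capr_word q f m) (val w).
Proof.
move=> pq; rewrite /capr ltnNge pq /= chain_ext_tpure //; last exact: capr_word_linear.
by move=> m'; apply: capr_word_mult.
Qed.

Hypothesis pq : (p < q)%N.
Let q0 : (0 < q)%N := leq_ltn_trans (leq0n p) pq.
Let qp0 : (0 < q - p)%N. Proof. by rewrite subn_gt0. Qed.
Let pq1 : (p <= q.-1)%N. Proof. by rewrite -ltnS prednK. Qed.

Lemma bK_chain_capl : bK_chain (capl f (tpure m w)) =
  word_ext (nu q) (lcap p q phi (dchain (q - p) (pure_word (q - p).-1)) m) (val w).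
Proof.
rewrite bK_chainE // capl_tpure ?(ltnW pq) //.
have h_mult m' : multilinear (nu (q - p)) (@bK_chain_word _ _ _ R (tensA P M) (q - p) m').
  exact: bK_chain_word_mult.
have h_lin := @bK_chain_word_linear _ _ _ R (tensA P M) (q - p).
rewrite -(word_ext_comp _ _ _ (chain_ext_linear h_mult h_lin)).
by rewrite (eqW_lcap f m h_mult h_lin (ltnW pq)) bK_chain_wordE.
Qed.

Lemma bK_chain_capr : bK_chain (capr f (tpure m w)) =
  word_ext (nu q) (rcap p q phi (dchain (q - p) (pure_word (q - p).-1)) m) (val w).
Proof.
rewrite bK_chainE // capr_tpure ?(ltnW pq) //.
have h_mult m' : multilinear (nu (q - p)) (@bK_chain_word _ _ _ R (tensA M P) (q - p) m').
  exact: bK_chain_word_mult.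
have h_lin := @bK_chain_word_linear _ _ _ R (tensA M P) (q - p).
rewrite -(word_ext_comp _ _ _ (chain_ext_linear h_mult h_lin)).
by rewrite (eqW_rcap f m h_mult h_lin (ltnW pq)) bK_chain_wordE.
Qed.

Lemma capl_bK_chain : capl f (bK_chain (tpure m w)) =
  word_ext (nu q) (dchain q (lcap p q.-1 phi (pure_word (q.-1 - p))) m) (val w).
Proof.
rewrite bK_chain_tpure // /capl ltnNge pq1 /=.
have h_mult m' : multilinear (nu q.-1) (@capl_word _ _ _ R M P p q.-1 f m').
  exact: capl_word_mult.
have h_lin := @capl_word_linear _ _ _ R M P p q.-1 f.
rewrite -(word_ext_comp _ _ _ (chain_ext_linear h_mult h_lin)).
by rewrite (eqW_dchain m h_mult h_lin q0) capl_wordE.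
Qed.

Lemma capr_bK_chain : capr f (bK_chain (tpure m w)) =
  word_ext (nu q) (dchain q (rcap p q.-1 phi (pure_word (q.-1 - p))) m) (val w).
Proof.
rewrite bK_chain_tpure // /capr ltnNge pq1 /=.
have h_mult m' : multilinear (nu q.-1) (@capr_word _ _ _ R M P p q.-1 f m').
  exact: capr_word_mult.
have h_lin := @capr_word_linear _ _ _ R M P p q.-1 f.
rewrite -(word_ext_comp _ _ _ (chain_ext_linear h_mult h_lin)).
by rewrite (eqW_dchain m h_mult h_lin q0) capr_wordE.
Qed.

Lemma capl_bK_cochain : capl (bK_cochain f) (tpure m w) =
  word_ext (nu q) (lcap p.+1 q (dcochain p phi) (pure_word (q - p.+1)) m) (val w).
Proof.
have -> : capl (bK_cochain f) (tpure m w) =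
    word_ext (nu q) (capl_word q (bK_cochain f) m) (val w).
  rewrite /capl ltnNge pq /= chain_ext_tpure //; last exact: capl_word_linear.
  by move=> m'; apply: capl_word_mult.
exact: eqW_lcap_cochain.
Qed.

Lemma capr_bK_cochain : capr (bK_cochain f) (tpure m w) =
  word_ext (nu q) (rcap p.+1 q (dcochain p phi) (pure_word (q - p.+1)) m) (val w).
Proof.
have -> : capr (bK_cochain f) (tpure m w) =
    word_ext (nu q) (capr_word q (bK_cochain f) m) (val w).
  rewrite /capr ltnNge pq /= chain_ext_tpure //; last exact: capr_word_linear.
  by move=> m'; apply: capr_word_mult.
exact: eqW_rcap_cochain.
Qed.

End OnPure.
End Comparison.

(** * The Leibniz formulas for the Koszul cap products *)

Unset Implicit Arguments.

Theorem proposition5p2 (k : fieldType) (V : lmodType k) (N : nat)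
    (R : homog_rel V N) (M P : bimodule (homalg R)) (p q : nat)
    (f : cochain P p) (z : chain M q) :
  bK_chain (capl f z) =
    chain_cast (subnS q p) (capl (bK_cochain f) z)
    + (-1) ^+ p *: chain_cast (esym (predn_sub q p)) (capl f (bK_chain z))
  /\
  bK_chain (capr f z) =
    chain_cast (esym (predn_sub q p)) (capr f (bK_chain z))
    + (-1) ^+ q *: chain_cast (subnS q p) (capr (bK_cochain f) z).
Proof.
have cast_lin M' d d' (e : d = d') := @chain_cast_linear _ _ _ R M' d d' e.
case: (leqP q p) => [qp|pq].
  rewrite bK_capl0 // bK_capr0 // capl_bK_cochain0 // capr_bK_cochain0 //.
  rewrite capl_bK_chain0 // capr_bK_chain0 //.
  by rewrite !(lin0 (cast_lin _ _ _ _)) !scaler0 !addr0.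
split.
  move: z; apply: tens_eq => [||m w].
  - exact: linear_comp_gen (bK_chain_linear (q := q - p)) (capl_linear f).
  - apply: linear_combr.
      exact: linear_comp_gen (cast_lin _ _ _ _) (capl_linear (bK_cochain f)).
    apply: linear_comp_gen (cast_lin _ _ _ _) _.
    exact: linear_comp_gen (capl_linear f) (bK_chain_linear (q := q)).
  rewrite bK_chain_capl // capl_bK_cochain // capl_bK_chain //.
  rewrite -!(word_ext_comp _ _ _ (cast_lin _ _ _ _)) -word_extZ -word_extD.
  apply: eq_word_ext => x _; rewrite lcap_dchain //; last exact: pure_word_linear.
  by rewrite chain_cast_lcap chain_cast_dchain_lcap.
move: z; apply: tens_eq => [||m w].
- exact: linear_comp_gen (bK_chain_linear (q := q - p)) (capr_linear f).
- apply: linear_combr.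
    apply: linear_comp_gen (cast_lin _ _ _ _) _.
    exact: linear_comp_gen (capr_linear f) (bK_chain_linear (q := q)).
  exact: linear_comp_gen (cast_lin _ _ _ _) (capr_linear (bK_cochain f)).
rewrite bK_chain_capr // capr_bK_cochain // capr_bK_chain //.
rewrite -!(word_ext_comp _ _ _ (cast_lin _ _ _ _)) -word_extZ -word_extD.
apply: eq_word_ext => x _; rewrite rcap_dchain //; last exact: pure_word_linear.
by rewrite chain_cast_rcap chain_cast_dchain_rcap.
Qed.
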